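(* Let $\mathfrak{g}$ be a finite-dimensional superspace and let $(\mathfrak{g},[\cdot,\cdot]_{\mathfrak{g}},\alpha_{\mathfrak{g}})$, $(\mathfrak{g}^*,[\cdot,\cdot]_{\mathfrak{g}^*},\alpha_{\mathfrak{g}}^* )$ be admissible multiplicative Hom-Lie superalgebras such that $(\mathfrak{g},\mathfrak{g}^* )$ is a Hom-Lie superbialgebra in the sense of conditions (C1) and (C2) of the context. Then $(\mathfrak{g}\oplus\mathfrak{g}^*,\mathfrak{g},\mathfrak{g}^* )$ is a Manin supertriple of Hom-Lie superalgebras, where $\mathfrak{g}\oplus\mathfrak{g}^*$ carries the twisting map $\alpha_{\mathfrak{g}}\oplus\alpha_{\mathfrak{g}}^*$, the bracket given for homogeneous $x+\xi$, $y+\eta$ (with $|x|=|\xi|$, $|y|=|\eta|$) by $$[x+\xi,y+\eta]_{\mathfrak{g}\oplus\mathfrak{g}^*}=[x,y]_{\mathfrak{g}}+[\xi,\eta]_{\mathfrak{g}^*}+ad^*_x(\eta)-(-1)^{|x||y|}ad^*_y(\xi)+\mathfrak{ad}^*_\xi(y)-(-1)^{|x||y|}\mathfrak{ad}^*_\eta(x),$$ and the bilinear form $S(x+\xi,y+\eta)=\langle x,\eta\rangle+\langle\xi,y\rangle$.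
   Context: $\mathbb{K}$ is a field of characteristic $0$; superspaces are $\mathbb{Z}_2$-graded; $|x|$ is the parity of a homogeneous $x$. A Hom-Lie superalgebra $(\mathfrak{L},[\cdot,\cdot],\alpha)$ is a superspace with an even bilinear bracket and an even linear map $\alpha$ such that $[x,y]=-(-1)^{|x||y|}[y,x]$ and $(-1)^{|x||z|}[\alpha(x),[y,z]]+(-1)^{|z||y|}[\alpha(z),[x,y]]+(-1)^{|y||x|}[\alpha(y),[z,x]]=0$; it is multiplicative if $\alpha([x,y])=[\alpha(x),\alpha(y)]$; it is admissible if $[(\mathrm{Id}-\alpha^2)(x),\alpha(y)]=0$ for all $x,y$. Pairing and coadjoint maps: $\langle\xi,x\rangle=\xi(x)$ and $\langle x,\xi\rangle=(-1)^{|x||\xi|}\langle\xi,x\rangle$ for $x\in\mathfrak{g}$, $\xi\in\mathfrak{g}^*$; $\alpha_{\mathfrak{g}}^*(\xi)=\xi\circ\alpha_{\mathfrak{g}}$. With $ad_x(y)=[x,y]_{\mathfrak{g}}$ and $\mathfrak{ad}_\xi(\eta)=[\xi,\eta]_{\mathfrak{g}^*}$, the maps $ad^*_x:\mathfrak{g}^*\to\mathfrak{g}^*$ and $\mathfrak{ad}^*_\xi:\mathfrak{g}\to\mathfrak{g}$ are defined by $\langle ad_x(y),\xi\rangle=-(-1)^{|x||y|}\langle y,ad^*_x(\xi)\rangle$ and $\langle\mathfrak{ad}_\xi(\eta),x\rangle=-(-1)^{|\xi||\eta|}\langle\eta,\mathfrak{ad}^*_\xi(x)\rangle$. They extend to $\wedge^2$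 by $ad^*_x(\xi\wedge\eta)=ad^*_x(\xi)\wedge\alpha_{\mathfrak{g}}^*(\eta)+(-1)^{|x||\xi|}\alpha_{\mathfrak{g}}^*(\xi)\wedge ad^*_x(\eta)$ and $\mathfrak{ad}^*_\xi(x\wedge y)=\mathfrak{ad}^*_\xi(x)\wedge\alpha_{\mathfrak{g}}(y)+(-1)^{|\xi||x|}\alpha_{\mathfrak{g}}(x)\wedge\mathfrak{ad}^*_\xi(y)$. The dual maps $\Delta:\mathfrak{g}\to\wedge^2\mathfrak{g}$ and $\Delta^*:\mathfrak{g}^*\to\wedge^2\mathfrak{g}^*$ are given by $\langle\Delta(x),\xi\wedge\eta\rangle=\langle x,[\xi,\eta]_{\mathfrak{g}^*}\rangle$ and $\langle\Delta^*(\xi),x\wedge y\rangle=\langle\xi,[x,y]_{\mathfrak{g}}\rangle$. On $\wedge^2$, $ad_x$ and $\mathfrak{ad}_\xi$ pair by the same duality: $\langle ad_x(P),\Xi\rangle=-(-1)^{|x||P|}\langle P,ad^*_x(\Xi)\rangle$ for $P\in\wedge^2\mathfrak{g}$, $\Xi\in\wedge^2\mathfrak{g}^*$, and symmetrically for $\mathfrak{ad}_\xi$ on $\wedge^2\mathfrak{g}^*$. $(\mathfrak{g},\mathfrak{g}^* )$ is a Hom-Lie superbialgebra if for all homogeneous $x,y\in\mathfrak{g}$, $\xi,\eta\in\mathfrak{g}^*$: (C1) $\langle\Delta([x,y]_{\mathfrak{g}}),\alpha_{\mathfrak{g}}^*(\xi)\wedge\eta\rangle=\langle ad_{\alpha_{\mathfrak{g}}(x)}(\Delta(y)),\alpha_{\mathfrak{g}}^*(\xi)\wedge\eta\rangle-(-1)^{|x||y|}\langle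 ad_{\alpha_{\mathfrak{g}}(y)}(\Delta(x)),\alpha_{\mathfrak{g}}^*(\xi)\wedge\eta\rangle$; (C2) $\langle\Delta^*([\xi,\eta]_{\mathfrak{g}^*}),\alpha_{\mathfrak{g}}(x)\wedge y\rangle=\langle\mathfrak{ad}_{\alpha_{\mathfrak{g}}^*(\xi)}(\Delta^*(\eta)),\alpha_{\mathfrak{g}}(x)\wedge y\rangle-(-1)^{|\xi||\eta|}\langle\mathfrak{ad}_{\alpha_{\mathfrak{g}}^*(\eta)}(\Delta^*(\xi)),\alpha_{\mathfrak{g}}(x)\wedge y\rangle$. A Manin supertriple of Hom-Lie superalgebras is a triple of Hom-Lie superalgebras $(\mathfrak{M},\mathfrak{g},\mathfrak{g}')$ with a nondegenerate supersymmetric bilinear form $S$ on $\mathfrak{M}$ (i.e. $S(v,w)=(-1)^{|v||w|}S(w,v)$) such that (1) $S$ is invariant: $S([x,y]_{\mathfrak{M}},z)=S(x,[y,z]_{\mathfrak{M}})$ and $S(\phi_{\mathfrak{M}}(x),y)=S(x,\phi_{\mathfrak{M}}(y))$, where $\phi_{\mathfrak{M}}$ is the twisting map of $\mathfrak{M}$; (2) $\mathfrak{g}$ and $\mathfrak{g}'$ are isotropic Hom-Lie sub-superalgebras of $\mathfrak{M}$ with $\mathfrak{M}=\mathfrak{g}\oplus\mathfrak{g}'$ as superspaces. *)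

(* Defs.v *)
From HB Require Import structures.
From mathcomp Require Import all_boot all_order all_algebra.

Set Implicit Arguments.
Unset Strict Implicit.
Unset Printing Implicit Defensive.

Import GRing.Theory.
Local Open Scope ring_scope.

Section Linear.
Variable K : fieldType.

Definition bilin (U V W : lmodType K) (F : U -> V -> W) : Prop :=
  (forall v, linear (F^~ v)) /\ (forall u, linear (F u)).

Lemma lin_lfunE (U V : vectType K) (f : U -> V) :
  linear f -> linfun f =1 f.
Proof.
move=> fL x; pose fl : {linear U -> V} :=
  HB.pack f (GRing.isLinear.Build K U V *:%R f fL).
exact: (lfunE fl).
Qed.

Lemma linear_props (U V : lmodType K) (f : U -> V) :
  linear f -> [/\ f 0 = 0, {morph f : x y / x + y}, {morph f : x / - x}
    & forall a, {morph f : x / a *: x}].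
Proof.
move=> fL; pose fl : {linear U -> V} :=
  HB.pack f (GRing.isLinear.Build K U V *:%R f fL).
by split; [exact: (raddf0 fl)|exact: (raddfD fl)|exact: (raddfN fl)
          |move=> a x; exact: (linearZZ fl)].
Qed.

Definition lfun2 (U V W : vectType K) (F : U -> V -> W) : 'Hom(U, 'Hom(V, W)) :=
  linfun (fun u => linfun (F u)).

Lemma lfun2E (U V W : vectType K) (F : U -> V -> W) :
  bilin F -> forall u v, lfun2 F u v = F u v.
Proof.
case=> F1 F2 u v; rewrite lin_lfunE ?lin_lfunE // => a x y.
apply/lfunP=> z; rewrite add_lfunE scale_lfunE !lin_lfunE //.
exact: (F1 z a x y).
Qed.

(* Every functional on the dual of a finite-dimensional space is the
   evaluation at a unique vector, see bidual_invE. *)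
Definition bidual_inv (V : vectType K) (F : 'Hom('Hom(V, K^o), K^o)) : V :=
  let b := vbasis (fullv : {vspace V}) in
  \sum_k F (linfun (coord b k : V -> K^o)) *: b`_k.

Lemma bidual_invE (V : vectType K) (F : 'Hom('Hom(V, K^o), K^o))
  (f : 'Hom(V, K^o)) : f (bidual_inv F) = F f.
Proof.
rewrite /bidual_inv; set b := vbasis _; rewrite linear_sum /=.
have bK v : v = \sum_k coord b k v *: b`_k.
  by apply: coord_vbasis; rewrite memvf.
have -> : F f = F (\sum_(k < \dim (fullv : {vspace V})) (f b`_k : K) *: linfun (coord b k : V -> K^o)).
  congr (F _); apply/lfunP=> v; rewrite sum_lfunE {1}(bK v) linear_sum /=.
  apply: eq_bigr => k _.
  rewrite linearZ scale_lfunE lfunE /= /GRing.scale /=; exact: mulrC.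
rewrite linear_sum; apply: eq_bigr => k _.
rewrite !linearZ /= /GRing.scale /=; exact: mulrC.
Qed.

Lemma fun_sep (V : vectType K) (v : V) :
  (forall f : 'Hom(V, K^o), f v = 0) -> v = 0.
Proof.
move=> f0; rewrite (coord_vbasis (memvf v)) big1 // => k _.
have := f0 (linfun (coord (vbasis fullv) k : V -> K^o)).
by rewrite lfunE /= => ->; rewrite scale0r.
Qed.

End Linear.

Section Superspaces.
Variable K : fieldType.

(* The parities 0 and 1 are the booleans false and true: parities add up by
   addb, and the Koszul sign (-1)^{|x||y|} is (-1) ^+ (i && j). *)
Record superspace := Superspace {
  sspace :> vectType K;
  spart : bool -> {vspace sspace};
  spart_add : (spart false + spart true)%VS = fullv;
  spart_cap : (spart false :&: spart true)%VS = 0%VS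
}.

Definition hproj (V : superspace) (i : bool) : 'End(V) :=
  daddv_pi (spart V i) (spart V (~~ i)).

(* The bilinear map sending homogeneous x, y to (-1)^{|x||y|} F x y, for F
   bilinear; see koszul_hom. *)
Definition koszul (V W : superspace) (U : lmodType K) (F : V -> W -> U)
    (x : V) (y : W) : U :=
  \sum_(i : bool) \sum_(j : bool) (-1) ^+ (i && j) *: F (hproj V i x) (hproj W j y).

Lemma spart_cap' (V : superspace) i : (spart V i :&: spart V (~~ i))%VS = 0%VS.
Proof. by case: i => /=; [rewrite capvC|]; exact: spart_cap. Qed.

Lemma hproj_mem (V : superspace) i (x : V) : hproj V i x \in spart V i.
Proof. exact: memv_pi. Qed.

Lemma hproj_id (V : superspace) i (x : V) :
  x \in spart V i -> hproj V i x = x.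
Proof. by apply: daddv_pi_id; exact: spart_cap'. Qed.

Lemma hproj_decomp (V : superspace) (x : V) :
  x = hproj V false x + hproj V true x.
Proof.
rewrite /hproj /= daddv_pi_add ?spart_cap ?spart_add ?memvf //.
Qed.

Lemma hproj_other (V : superspace) i (x : V) :
  x \in spart V i -> hproj V (~~ i) x = 0.
Proof.
move=> xi; have e : x = hproj V i x + hproj V (~~ i) x.
  by case: (i); [rewrite addrC|]; exact: hproj_decomp.
by apply: (addrI x); rewrite addr0 [RHS]e (hproj_id xi).
Qed.

Lemma hproj_hproj (V : superspace) i j (x : V) :
  hproj V i (hproj V j x) = if i == j then hproj V j x else 0.
Proof.
case: eqP => [->|/eqP ij]; first by rewrite hproj_id ?hproj_mem.
have -> : i = ~~ j by case: i j ij => [] [].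
by rewrite hproj_other ?hproj_mem.
Qed.

Lemma hproj_neq (V : superspace) i j (x : V) :
  x \in spart V i -> j != i -> hproj V j x = 0.
Proof. by move=> xi ji; rewrite (_ : j = ~~ i) ?hproj_other //; case: i j ji {xi} => [] []. Qed.

Lemma koszul_hom (V W : superspace) (U : lmodType K) (F : V -> W -> U) i j x y :
  bilin F -> x \in spart V i -> y \in spart W j ->
  koszul F x y = (-1) ^+ (i && j) *: F x y.
Proof.
case=> F1 F2 xi yj; have F0l v : F 0 v = 0 by case: (linear_props (F1 v)).
have F0r u : F u 0 = 0 by case: (linear_props (F2 u)).
rewrite /koszul (bigD1 i) //= (bigD1 j) //= hproj_id // hproj_id //.
rewrite [X in _ + X + _]big1 ?addr0 => [|k kj].
  rewrite [X in _ + X]big1 ?addr0 // => k ki; apply: big1 => l _.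
  by rewrite (hproj_neq xi ki) F0l scaler0.
by rewrite (hproj_neq yj kj) F0r scaler0.
Qed.

Lemma bilin_koszul (V W : superspace) (U : lmodType K) (F : V -> W -> U) :
  bilin F -> bilin (koszul F).
Proof.
case=> F1 F2; split=> [v|u] a x y; rewrite /koszul.
- rewrite scaler_sumr -big_split; apply: eq_bigr => i _ /=.
  rewrite scaler_sumr -big_split; apply: eq_bigr => j _ /=.
  rewrite linearP; rewrite (F1 _ a); rewrite scalerDr !scalerA mulrC //.
- rewrite scaler_sumr -big_split; apply: eq_bigr => i _ /=.
  rewrite scaler_sumr -big_split; apply: eq_bigr => j _ /=.
  rewrite linearP; rewrite (F2 _ a); rewrite scalerDr !scalerA mulrC //.
Qed.

(* Superspace given by complementary idempotents. *)
Section OfProj.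
Variables (V : vectType K) (p : bool -> 'End(V)).
Hypothesis p_add : forall v, p false v + p true v = v.
Hypothesis p_id : forall i v, p i (p i v) = p i v.

Lemma limg_idem i v : (v \in limg (p i)) = (p i v == v).
Proof.
apply/idP/eqP => [/memv_imgP[w _ ->]|<-]; first exact: p_id.
by rewrite memv_img ?memvf.
Qed.

Fact of_proj_add : (limg (p false) + limg (p true))%VS = fullv.
Proof.
apply/eqP; rewrite eqEsubv subvf /=; apply/subvP=> v _.
by rewrite -(p_add v) memv_add ?memv_img ?memvf.
Qed.

Fact of_proj_cap : (limg (p false) :&: limg (p true))%VS = 0%VS.
Proof.
apply/eqP; rewrite -subv0; apply/subvP=> v.
rewrite memv_cap !limg_idem memv0 => /andP[/eqP h0 /eqP h1].
have /eqP := p_add v; rewrite h0 h1.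
by rewrite -[X in _ == X]addr0 (inj_eq (addrI v)).
Qed.

Definition sspace_of_proj : superspace :=
  @Superspace V (fun i => limg (p i)) of_proj_add of_proj_cap.

Lemma hproj_of_proj i v : hproj sspace_of_proj i v = p i v.
Proof.
have m j : p j v \in spart sspace_of_proj j by rewrite memv_img ?memvf.
have h : hproj sspace_of_proj i v =
  hproj sspace_of_proj i (p false v) + hproj sspace_of_proj i (p true v).
  by rewrite -linearD /= p_add.
rewrite h; case: i h => _.
  by rewrite (hproj_id (m true)) (hproj_neq (m false)) ?add0r.
by rewrite (hproj_id (m false)) (hproj_neq (m true)) ?addr0.
Qed.
End OfProj.

(* The dual superspace: (V^* )_i is the set of forms xi with
   xi \o hproj V i = xi, i.e. which vanish on V_(1 - i), see dual_partP. *)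
Definition dual_proj (V : superspace) (i : bool) : 'End('Hom(V, K^o)) :=
  linfun (fun xi : 'Hom(V, K^o) => (xi \o hproj V i)%VF).

Lemma dual_projE (V : superspace) i (xi : 'Hom(V, K^o)) :
  dual_proj V i xi = (xi \o hproj V i)%VF.
Proof.
by rewrite lin_lfunE // => a x y; rewrite comp_lfunDl comp_lfunZl.
Qed.

Fact dual_proj_add (V : superspace) v : dual_proj V false v + dual_proj V true v = v.
Proof.
apply/lfunP=> x; rewrite add_lfunE !dual_projE !comp_lfunE /=.
by rewrite -linearD /= -hproj_decomp.
Qed.

Fact dual_proj_id (V : superspace) i v :
  dual_proj V i (dual_proj V i v) = dual_proj V i v.
Proof.
by apply/lfunP=> x; rewrite !dual_projE !comp_lfunE /= hproj_hproj eqxx.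
Qed.

Definition dual (V : superspace) : superspace :=
  sspace_of_proj (@dual_proj_add V) (@dual_proj_id V).

(* <xi, x> *)
Definition ev (V : superspace) (xi : dual V) (x : V) : K^o :=
  (xi : 'Hom(V, K^o)) x.

Lemma dual_partP (V : superspace) i (xi : dual V) :
  reflect (forall x, x \in spart V (~~ i) -> ev xi x = 0) (xi \in spart (dual V) i).
Proof.
rewrite /ev /= limg_idem; last exact: dual_proj_id.
rewrite dual_projE.
apply: (iffP eqP) => [h x xi'|h].
  by rewrite -h comp_lfunE /= (hproj_neq xi') ?linear0 //; case: (i).
apply/lfunP=> x; rewrite comp_lfunE /= [in RHS](hproj_decomp x) linearD /=.
by case: i h => h; [rewrite (h (hproj V false x)) ?hproj_mem // add0r
                   |rewrite (h (hproj V true x)) ?hproj_mem // addr0].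
Qed.

Lemma bilin_ev (V : superspace) : bilin (@ev V).
Proof.
split=> [x|xi] a u v; rewrite /ev; last by rewrite linearP.
by rewrite add_lfunE scale_lfunE.
Qed.

(* <x, xi> = (-1)^{|x||xi|} <xi, x> *)
Definition coev (V : superspace) (x : V) (xi : dual V) : K^o :=
  koszul (fun x xi => ev xi x) x xi.

(* The direct sum V + W, graded by (V + W)_i = V_i + W_i. *)
Definition dsum_proj (V W : superspace) (i : bool) : 'End((V * W)%type) :=
  linfun (fun u : V * W => (hproj V i u.1, hproj W i u.2)).

Lemma dsum_projE (V W : superspace) i (u : V * W) :
  dsum_proj V W i u = (hproj V i u.1, hproj W i u.2).
Proof. by rewrite lin_lfunE // => a x y; rewrite /= !linearP. Qed.

Fact dsum_proj_add (V W : superspace) u :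
  dsum_proj V W false u + dsum_proj V W true u = u.
Proof. by case: u => x y; rewrite !dsum_projE /=; congr (_, _); rewrite /= -hproj_decomp. Qed.

Fact dsum_proj_id (V W : superspace) i u :
  dsum_proj V W i (dsum_proj V W i u) = dsum_proj V W i u.
Proof. by rewrite !dsum_projE /= !hproj_hproj eqxx. Qed.

Definition dsum (V W : superspace) : superspace :=
  sspace_of_proj (@dsum_proj_add V W) (@dsum_proj_id V W).

Lemma dsum_partE (V W : superspace) i (x : V) (y : W) :
  ((x, y) \in spart (dsum V W) i) = (x \in spart V i) && (y \in spart W i).
Proof.
rewrite /= limg_idem; last exact: dsum_proj_id.
rewrite dsum_projE xpair_eqE /=; congr (_ && _).
  by apply/eqP/idP => [<-|/hproj_id //]; rewrite hproj_mem.
by apply/eqP/idP => [<-|/hproj_id //]; rewrite hproj_mem.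
Qed.

End Superspaces.

Section ExteriorSquare.
Variable K : fieldType.

Definition super_skew (W : superspace K) (U : lmodType K) (F : W -> W -> U) : Prop :=
  forall i j a b, a \in spart W i -> b \in spart W j ->
  F a b = - ((-1) ^+ (i && j) *: F b a).

Lemma bilin_hom0 (V W : superspace K) (U : lmodType K) (F : V -> W -> U) :
  bilin F ->
  (forall i j a b, a \in spart V i -> b \in spart W j -> F a b = 0) ->
  forall a b, F a b = 0.
Proof.
case=> F1 F2 F0 a b; rewrite (hproj_decomp a) (hproj_decomp b).
case: (linear_props (F1 (hproj W false b + hproj W true b))) => _ -> _ _.
case: (linear_props (F2 (hproj V false a))) => _ -> _ _.
case: (linear_props (F2 (hproj V true a))) => _ -> _ _.
by rewrite !(F0 _ _ _ _ (hproj_mem _ _) (hproj_mem _ _)) !addr0.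
Qed.

Lemma bilin_lfun (U V W : vectType K) (B : 'Hom(U, 'Hom(V, W))) :
  bilin (fun a b => B a b).
Proof.
by split=> [v|u] a x y; rewrite linearP // add_lfunE scale_lfunE.
Qed.

Lemma bilinD (U V W : lmodType K) (F G : U -> V -> W) :
  bilin F -> bilin G -> bilin (fun a b => F a b + G a b).
Proof.
case=> F1 F2 [G1 G2]; split=> [v|u] a x y.
  by rewrite (F1 v a) (G1 v a) /= scalerDr addrACA.
by rewrite (F2 u a) (G2 u a) /= scalerDr addrACA.
Qed.

Lemma bilin_flip (U V W : lmodType K) (F : U -> V -> W) :
  bilin F -> bilin (fun b a => F a b).
Proof. by case. Qed.

Variable W : superspace K.

(* The super-skew-symmetric bilinear forms on W. *)
Definition skew_defect (B : 'Hom(W, 'Hom(W, K^o))) : 'Hom(W, 'Hom(W, K^o)) :=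
  lfun2 (fun a b => B a b + koszul (fun a b => B b a) a b).

Definition skew_forms : {vspace 'Hom(W, 'Hom(W, K^o))} :=
  lker (linfun skew_defect).

Lemma skew_defectE B a b :
  skew_defect B a b = B a b + koszul (fun a b => B b a) a b.
Proof.
rewrite /skew_defect lfun2E //; apply: bilinD; first exact: bilin_lfun.
by apply/bilin_koszul/bilin_flip/bilin_lfun.
Qed.

Lemma skew_formsP B :
  B \in skew_forms <-> super_skew (fun a b => B a b).
Proof.
rewrite memv_ker lin_lfunE; last first.
  move=> a x y; apply/lfunP=> u; apply/lfunP=> v.
  rewrite !(add_lfunE, scale_lfunE, skew_defectE) /koszul.
  rewrite scalerDr addrACA; congr (_ + _).
  rewrite scaler_sumr -big_split; apply: eq_bigr => i _ /=.
  rewrite scaler_sumr -big_split; apply: eq_bigr => j _ /=.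
  by rewrite !(add_lfunE, scale_lfunE) scalerDr !scalerA mulrC.
have bl := bilin_lfun B.
split=> [/eqP B0 i j a b ai bj|Bs].
  have := skew_defectE B a b; rewrite B0 !zero_lfunE.
  rewrite (koszul_hom (bilin_flip bl) ai bj) => /esym/eqP.
  by rewrite addr_eq0 => /eqP.
apply/eqP/lfunP=> a; apply/lfunP=> b; rewrite !zero_lfunE skew_defectE.
apply: (bilin_hom0 (F := fun a b => B a b + koszul (fun a b => B b a) a b)).
  by apply: bilinD => //; apply/bilin_koszul/bilin_flip.
move=> i j {}a {}b ai bj; rewrite (koszul_hom (bilin_flip bl) ai bj).
by rewrite (Bs i j a b ai bj) addNr.
Qed.

(* The exterior square of W, constructed as the dual of the space of
   super-skew-symmetric bilinear forms on W; it has the universal property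
   ext2_lift_wedge, ext2_lift_unique. *)
Definition ext2v : vectType K := 'Hom(subvs_of skew_forms, K^o).

Definition wedge (a b : W) : ext2v :=
  linfun (fun B : subvs_of skew_forms => vsval B a b : K^o).

Lemma wedgeE a b (B : subvs_of skew_forms) :
  (wedge a b : 'Hom(_, _)) B = vsval B a b.
Proof.
by rewrite lin_lfunE // => c x y; rewrite linearP add_lfunE scale_lfunE add_lfunE scale_lfunE.
Qed.

Lemma bilin_wedge : bilin wedge.
Proof.
split=> [v|u] a x y; apply/lfunP=> B;
by rewrite add_lfunE scale_lfunE !wedgeE linearP // add_lfunE scale_lfunE.
Qed.

Lemma wedge_skew : super_skew wedge.
Proof.
move=> i j a b ai bj; apply/lfunP=> B.
rewrite opp_lfunE scale_lfunE !wedgeE.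
have /skew_formsP Bs : vsval B \in skew_forms by exact: subvsP.
exact: (Bs i j a b ai bj).
Qed.

(* The linear map on the exterior square sending wedge a b to F a b, for F
   bilinear and super-skew-symmetric. *)
Definition ext2_lift (U : vectType K) (F : W -> W -> U) : 'Hom(ext2v, U) :=
  let u := vbasis (fullv : {vspace U}) in
  linfun (fun X : ext2v => \sum_k
    (X : 'Hom(subvs_of skew_forms, K^o))
      (vsproj skew_forms (lfun2 (fun a b => coord u k (F a b) : K^o))) *: u`_k).

Lemma ext2_lift_wedge (U : vectType K) (F : W -> W -> U) :
  bilin F -> super_skew F -> forall a b, ext2_lift F (wedge a b) = F a b.
Proof.
case=> F1 F2 Fs a b; rewrite /ext2_lift lin_lfunE; last first.
  move=> c x y; rewrite scaler_sumr -big_split; apply: eq_bigr => k _ /=.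
  by rewrite add_lfunE scale_lfunE scalerDl scalerA.
rewrite [RHS](coord_vbasis (memvf _)); apply: eq_bigr => k _.
have bk : bilin (fun a b => coord (vbasis fullv) k (F a b) : K^o).
  by split=> [v|u] c x y; [rewrite (F1 v c)|rewrite (F2 u c)]; rewrite linearP.
rewrite wedgeE vsprojK ?lfun2E //; apply/skew_formsP=> i j x y xi yj.
by rewrite !lfun2E // (Fs i j x y xi yj) linearN linearZ.
Qed.

Lemma ext2_lift_unique (U : vectType K) (D E : 'Hom(ext2v, U)) :
  (forall a b, D (wedge a b) = E (wedge a b)) -> D = E.
Proof.
move=> DE; apply/lfunP=> X; apply/eqP; rewrite -subr_eq0; apply/eqP.
apply: fun_sep => f; pose G : 'Hom(ext2v, K^o) := (f \o (D - E))%VF.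
have -> : f (D X - E X) = G X by rewrite comp_lfunE add_lfunE opp_lfunE.
rewrite -(bidual_invE G); suff -> : bidual_inv G = 0 by rewrite linear0.
apply: val_inj; apply/lfunP=> a; apply/lfunP=> b.
rewrite -[LHS]wedgeE bidual_invE comp_lfunE add_lfunE opp_lfunE DE subrr.
by rewrite linear0 /= !zero_lfunE.
Qed.

(* The grading of the exterior square: a /\ b has parity |a| + |b|. *)
Definition ext2_proj (i : bool) : 'End(ext2v) :=
  ext2_lift (fun a b => \sum_(j : bool) wedge (hproj W j a) (hproj W (i (+) j) b)).

Lemma ext2_projE i a b : ext2_proj i (wedge a b) =
  \sum_(j : bool) wedge (hproj W j a) (hproj W (i (+) j) b).
Proof.
apply: (ext2_lift_wedge (F := fun a b => \sum_(j : bool) _)).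
  split=> [v|u] c x y; rewrite scaler_sumr -big_split; apply: eq_bigr => j _ /=;
  by rewrite linearP; apply: bilin_wedge.1 || apply: bilin_wedge.2.
have [w1 w2] := bilin_wedge.
have w0 u : wedge 0 u = 0 by case: (linear_props (w1 u)).
have w0r u : wedge u 0 = 0 by case: (linear_props (w2 u)).
have key p q x y : x \in spart W p -> y \in spart W q ->
    \sum_(j : bool) wedge (hproj W j x) (hproj W (i (+) j) y) =
    if i == p (+) q then wedge x y else 0.
  move=> xp yq; rewrite (bigD1 p) //= big1 ?addr0 => [|j jp].
    rewrite (hproj_id xp); case: eqP => [->|/eqP ip].
      by rewrite addbC addbA addbb hproj_id.
    by rewrite (hproj_neq yq) ?w0r //; case: (i) (p) (q) ip => [] [] [].
  by rewrite (hproj_neq xp jp) w0.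
move=> p q x y xp yq; rewrite !(key _ _ _ _ xp yq) !(key _ _ _ _ yq xp).
rewrite addbC; case: eqP => _; last by rewrite scaler0 oppr0.
exact: wedge_skew.
Qed.

Fact ext2_proj_add X : ext2_proj false X + ext2_proj true X = X.
Proof.
rewrite -add_lfunE -[RHS]id_lfunE; congr (fun_of_lfun _ X).
apply: ext2_lift_unique => a b; rewrite id_lfunE add_lfunE !ext2_projE.
have [w1 w2] := bilin_wedge.
have wl u : {morph wedge^~ u : x y / x + y} by case: (linear_props (w1 u)).
have wr u : {morph wedge u : x y / x + y} by case: (linear_props (w2 u)).
rewrite [in RHS](hproj_decomp a) [in RHS](hproj_decomp b) !big_bool /=.
by rewrite wl !wr [LHS]addrACA [LHS]addrC; congr (_ + _); rewrite addrC.
Qed.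

Fact ext2_proj_id i X : ext2_proj i (ext2_proj i X) = ext2_proj i X.
Proof.
rewrite -comp_lfunE; congr (fun_of_lfun _ X).
apply: ext2_lift_unique => a b; rewrite comp_lfunE ext2_projE linear_sum /=.
apply: eq_bigr => j _; rewrite ext2_projE (bigD1 j) //= big1 ?addr0 => [|k kj].
  by rewrite !hproj_hproj !eqxx.
rewrite !hproj_hproj (negPf kj).
by case: (linear_props (bilin_wedge.1 (if i (+) k == i (+) j then hproj W (i (+) j) b else 0))).
Qed.

Definition ext2 : superspace K := sspace_of_proj ext2_proj_add ext2_proj_id.

End ExteriorSquare.

Section HomLie.
Variable K : fieldType.

Record hom_lie_superalgebra (V : superspace K) (br : V -> V -> V)
    (al : 'End(V)) : Prop := HomLieSuperalgebra {
  hls_bilin : bilin br;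
  hls_even : forall i j x y, x \in spart V i -> y \in spart V j ->
    br x y \in spart V (i (+) j);
  hls_twist_even : forall i x, x \in spart V i -> al x \in spart V i;
  hls_skew : forall i j x y, x \in spart V i -> y \in spart V j ->
    br x y = - ((-1) ^+ (i && j) *: br y x);
  hls_jacobi : forall i j k x y z,
    x \in spart V i -> y \in spart V j -> z \in spart V k ->
    (-1) ^+ (i && k) *: br (al x) (br y z)
    + (-1) ^+ (k && j) *: br (al z) (br x y)
    + (-1) ^+ (j && i) *: br (al y) (br z x) = 0
}.

Definition hom_multiplicative (V : superspace K) (br : V -> V -> V) (al : 'End(V)) :=
  forall x y, al (br x y) = br (al x) (al y).

Definition hom_admissible (V : superspace K) (br : V -> V -> V) (al : 'End(V)) :=
  forall x y, br (x - al (al x)) (al y) = 0.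

(* al^* (xi) = xi \o al *)
Definition dual_map (V : superspace K) (al : 'End(V)) : 'End(dual V) :=
  linfun (fun xi : 'Hom(V, K^o) => (xi \o al)%VF : 'Hom(V, K^o)).

(* The contragredient action of V on E^*, for T : V -> End(E):
   <T^*_x (P), e> = - (-1)^{|x||P|} <P, T_x (e)>. *)
Definition dual_act (V E : superspace K) (T : V -> 'End(E)) (x : V)
    (P : dual E) : dual E :=
  - koszul (fun x (P : dual E) => ((P : 'Hom(E, K^o)) \o T x)%VF : dual E) x P.

(* ad^*_x : V^* -> V^*; the defining identity is adstarP. *)
Definition adstar (V : superspace K) (br : V -> V -> V) (x : V) (xi : dual V) :
    dual V :=
  dual_act (fun x => linfun (br x)) x xi.

(* ad^*_xi : V -> V for a bracket on V^*, V being identified with its bidual;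
   the defining identity is coadstarP. *)
Definition coadstar (V : superspace K) (brd : dual V -> dual V -> dual V)
    (xi : dual V) (x : V) : V :=
  bidual_inv (linfun (fun eta : dual V =>
    - koszul (fun xi eta => ev (brd xi eta) x) xi eta : K^o)).

(* The extension of an action a of V on W to the exterior square of W, twisted
   by al: a_x (u /\ v) = a_x u /\ al v + (-1)^{|x||u|} al u /\ a_x v. *)
Definition ext2_act (V W : superspace K) (a : V -> W -> W) (al : 'End(W))
    (x : V) : 'End(ext2 W) :=
  ext2_lift (fun u v => wedge (a x u) (al v)
    + koszul (fun x u => wedge (al u) (a x v)) x u).

(* The pairing identifies ext2 V with the dual of ext2 (dual V), and
   ext2 (dual V) with the dual of ext2 V. Elements P of ext2 V enter the
   definition of a Hom-Lie superbialgebra only through their pairings with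
   elements of ext2 (dual V): they are taken in dual (ext2 (dual V)), and
   <P, X> is ev P X; similarly with the roles of V and dual V exchanged. *)

(* <Delta x, xi /\ eta> = <x, [xi, eta]> *)
Definition Delta (V : superspace K) (brd : dual V -> dual V -> dual V) (x : V) :
    dual (ext2 (dual V)) :=
  ext2_lift (fun xi eta => coev x (brd xi eta)).

(* <Delta^* xi, x /\ y> = <xi, [x, y]> *)
Definition Deltastar (V : superspace K) (br : V -> V -> V) (xi : dual V) :
    dual (ext2 V) :=
  ext2_lift (fun x y => ev xi (br x y)).

(* ad_x on ext2 V:
   <ad_x P, X> = - (-1)^{|x||P|} <P, ad^*_x X> for X in ext2 (dual V) *)
Definition ad2 (V : superspace K) (br : V -> V -> V) (al : 'End(V)) :
    V -> dual (ext2 (dual V)) -> dual (ext2 (dual V)) :=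
  dual_act (ext2_act (adstar br) (dual_map al)).

(* ad_xi on ext2 (dual V):
   <ad_xi P, X> = - (-1)^{|xi||P|} <P, ad^*_xi X> for X in ext2 V *)
Definition coad2 (V : superspace K) (brd : dual V -> dual V -> dual V)
    (al : 'End(V)) : dual V -> dual (ext2 V) -> dual (ext2 V) :=
  dual_act (ext2_act (coadstar brd) al).

Record hom_lie_superbialgebra (g : superspace K) (br : g -> g -> g)
    (brd : dual g -> dual g -> dual g) (al : 'End(g)) : Prop :=
  HomLieSuperbialgebra {
  hlsb_compat : forall i j k l (x y : g) (xi eta : dual g),
    x \in spart g i -> y \in spart g j ->
    xi \in spart (dual g) k -> eta \in spart (dual g) l ->
    let X := wedge (dual_map al xi) eta in
    ev (Delta brd (br x y)) X
    = ev (ad2 br al (al x) (Delta brd y)) X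
      - (-1) ^+ (i && j) * ev (ad2 br al (al y) (Delta brd x)) X;
  hlsb_cocompat : forall i j k l (xi eta : dual g) (x y : g),
    xi \in spart (dual g) i -> eta \in spart (dual g) j ->
    x \in spart g k -> y \in spart g l ->
    let X := wedge (al x) y in
    ev (Deltastar br (brd xi eta)) X
    = ev (coad2 brd al (dual_map al xi) (Deltastar br eta)) X
      - (-1) ^+ (i && j) * ev (coad2 brd al (dual_map al eta) (Deltastar br xi)) X
}.

Record hom_lie_subsuperalgebra (M : superspace K) (brM : M -> M -> M)
    (phi : 'End(M)) (V : superspace K) (br : V -> V -> V) (al : 'End(V))
    (iota : 'Hom(V, M)) : Prop := HomLieSubsuperalgebra {
  sub_inj : injective iota;
  sub_even : forall i x, x \in spart V i -> iota x \in spart M i;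
  sub_bracket : forall x y, iota (br x y) = brM (iota x) (iota y);
  sub_twist : forall x, iota (al x) = phi (iota x)
}.

(* The Manin supertriple (M, g, g'), where g and g' are regarded as
   sub-superalgebras of M through iota and iota'. *)
Record manin_supertriple (M : superspace K) (brM : M -> M -> M)
    (phi : 'End(M)) (S : M -> M -> K^o)
    (g : superspace K) (br : g -> g -> g) (al : 'End(g)) (iota : 'Hom(g, M))
    (g' : superspace K) (br' : g' -> g' -> g') (al' : 'End(g'))
    (iota' : 'Hom(g', M)) : Prop := ManinSupertriple {
  mst_M : hom_lie_superalgebra brM phi;
  mst_g : hom_lie_superalgebra br al;
  mst_g' : hom_lie_superalgebra br' al';
  mst_form_bilin : bilin S;
  mst_form_nondeg : forall v, (forall w, S v w = 0) -> v = 0;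
  mst_form_supersym : forall i j v w, v \in spart M i -> w \in spart M j ->
    S v w = (-1) ^+ (i && j) * S w v;
  mst_form_inv : forall x y z, S (brM x y) z = S x (brM y z);
  mst_form_twist : forall x y, S (phi x) y = S x (phi y);
  mst_sub : hom_lie_subsuperalgebra brM phi br al iota;
  mst_sub' : hom_lie_subsuperalgebra brM phi br' al' iota';
  mst_isotropic : forall x y, S (iota x) (iota y) = 0;
  mst_isotropic' : forall x y, S (iota' x) (iota' y) = 0;
  mst_add : forall i, (iota @: spart g i + iota' @: spart g' i)%VS = spart M i;
  mst_cap : (limg iota :&: limg iota')%VS = 0%VS
}.

Section Double.
Variables (g : superspace K) (br : g -> g -> g)
  (brd : dual g -> dual g -> dual g) (al : 'End(g)).

Definition dsum_inl (V W : superspace K) : 'Hom(V, dsum V W) :=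
  linfun (fun x : V => (x, 0) : (V * W)%type).
Definition dsum_inr (V W : superspace K) : 'Hom(W, dsum V W) :=
  linfun (fun y : W => (0, y) : (V * W)%type).
Definition dsum_map (V W : superspace K) (f : 'End(V)) (h : 'End(W)) :
    'End(dsum V W) :=
  linfun (fun u : V * W => (f u.1, h u.2) : (V * W)%type).

(* The bilinear extension of the bracket of g + g^*; the formula on
   homogeneous elements is double_bracketE. *)
Definition double_bracket (u v : dsum g (dual g)) : dsum g (dual g) :=
  let: (x, xi) := u : g * dual g in
  let: (y, eta) := v : g * dual g in
  (br x y + coadstar brd xi y - koszul (fun x eta => coadstar brd eta x) x eta,
   brd xi eta + adstar br x eta - koszul (fun xi y => adstar br y xi) xi y).

Definition double_form (u v : dsum g (dual g)) : K^o :=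
  let: (x, xi) := u : g * dual g in
  let: (y, eta) := v : g * dual g in
  coev x eta + ev xi y.

End Double.

End HomLie.

Section HomLieFacts.
Variable K : fieldType.
Implicit Types V W E : superspace K.

Lemma bilin_coev V : bilin (@coev K V).
Proof. by apply: bilin_koszul; apply: bilin_flip; exact: bilin_ev. Qed.

Lemma coev_hom V i j (x : V) (xi : dual V) :
  x \in spart V i -> xi \in spart (dual V) j ->
  coev x xi = (-1) ^+ (i && j) * ev xi x.
Proof. exact: (koszul_hom (bilin_flip (@bilin_ev K V))). Qed.

Lemma dual_mapE V (al : 'End(V)) (xi : dual V) x :
  ev (dual_map al xi) x = ev xi (al x).
Proof.
rewrite /ev /dual_map lin_lfunE ?comp_lfunE // => a u v.
by rewrite comp_lfunDl comp_lfunZl.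
Qed.

Lemma dual_map_even V (al : 'End(V)) :
  (forall i x, x \in spart V i -> al x \in spart V i) ->
  forall i xi, xi \in spart (dual V) i -> dual_map al xi \in spart (dual V) i.
Proof.
move=> al0 i xi /dual_partP xi0; apply/dual_partP=> x xi'.
by rewrite dual_mapE xi0 // al0.
Qed.

Lemma bilin_dual_act V E (T : V -> 'End(E)) : linear T -> bilin (dual_act T).
Proof.
move=> TL; have B : bilin (koszul (fun x (P : dual E) =>
    ((P : 'Hom(E, K^o)) \o T x)%VF : dual E)).
  apply: bilin_koszul; split=> [P|x] a u v; apply/lfunP=> e.
    rewrite TL; rewrite !(comp_lfunE, add_lfunE, scale_lfunE).
    by rewrite linearP.
  by rewrite !(comp_lfunE, add_lfunE, scale_lfunE).
split=> [P|x] a u v; rewrite /dual_act.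
  by rewrite (B.1 P a u v) opprD scalerN.
by rewrite (B.2 x a u v) opprD scalerN.
Qed.

Lemma dual_actP V E (T : V -> 'End(E)) i j x (P : dual E) e : linear T ->
  x \in spart V i -> P \in spart (dual E) j ->
  ev (dual_act T x P) e = - ((-1) ^+ (i && j) * ev P (T x e)).
Proof.
move=> TL xi Pj; rewrite /ev /dual_act.
rewrite (koszul_hom (F := fun x (P : dual E) =>
   ((P : 'Hom(E, K^o)) \o T x)%VF : dual E) _ xi Pj).
  by rewrite opp_lfunE scale_lfunE comp_lfunE.
split=> [Q|y] a u v; apply/lfunP=> z.
  rewrite TL; rewrite !(comp_lfunE, add_lfunE, scale_lfunE).
  by rewrite linearP.
by rewrite !(comp_lfunE, add_lfunE, scale_lfunE).
Qed.

Lemma linear_ad V (br : V -> V -> V) :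
  bilin br -> linear (fun x => linfun (br x)).
Proof.
case=> b1 b2 a x y; apply/lfunP=> z.
by rewrite add_lfunE scale_lfunE !lin_lfunE // (b1 z a).
Qed.

Lemma bilin_adstar V (br : V -> V -> V) : bilin br -> bilin (adstar br).
Proof. by move=> b; apply: bilin_dual_act; exact: linear_ad. Qed.

Lemma adstarE V (br : V -> V -> V) i j x xi y : bilin br ->
  x \in spart V i -> xi \in spart (dual V) j ->
  ev (adstar br x xi) y = - ((-1) ^+ (i && j) * ev xi (br x y)).
Proof.
move=> b xi' xij; rewrite (dual_actP _ (linear_ad b) xi' xij).
by rewrite lin_lfunE //; case: b.
Qed.

Section Bracket.
Variables (V : superspace K) (br : V -> V -> V).
Hypothesis br_bilin : bilin br.
Hypothesis br_even : forall i j x y, x \in spart V i -> y \in spart V j ->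
  br x y \in spart V (i (+) j).

Lemma adstar_even i j x xi : x \in spart V i -> xi \in spart (dual V) j ->
  adstar br x xi \in spart (dual V) (i (+) j).
Proof.
move=> xi' xij; apply/dual_partP=> y yk.
rewrite (adstarE _ br_bilin xi' xij) (elimT (dual_partP _ _) xij) ?mulr0 ?oppr0 //.
by have := br_even xi' yk; rewrite addbN addbA addbb.
Qed.

(* <ad_x y, xi> = - (-1)^{|x||y|} <y, ad^*_x xi> *)
Lemma adstarP i j k x y xi :
  x \in spart V i -> y \in spart V j -> xi \in spart (dual V) k ->
  coev (br x y) xi = - ((-1) ^+ (i && j) * coev y (adstar br x xi)).
Proof.
move=> xi' yj xik; rewrite (coev_hom (br_even xi' yj) xik).
rewrite (coev_hom yj (adstar_even xi' xik)) (adstarE _ br_bilin xi' xik).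
rewrite !mulrN opprK !mulrA -!signr_addb; congr (_ ^+ _ * _).
by case: i j k {xi' yj xik} => [] [] [].
Qed.

Lemma Deltastar_wedge xi x y :
  super_skew br -> Deltastar br xi (wedge x y) = ev xi (br x y).
Proof.
move=> sk; case: br_bilin => b1 b2; apply: ext2_lift_wedge.
  by split=> [v|u] a p q; rewrite ?(b1 v a) ?(b2 u a); exact: (bilin_ev V).2.
move=> i j a b ai bj; rewrite (sk i j a b ai bj).
by case: (linear_props ((bilin_ev V).2 xi)) => _ _ -> ->.
Qed.
End Bracket.

Section Cobracket.
Variables (V : superspace K) (brd : dual V -> dual V -> dual V).
Hypothesis brd_bilin : bilin brd.

Lemma coadstarE xi eta x : ev eta (coadstar brd xi x) =
  - koszul (fun xi eta => ev (brd xi eta) x) xi eta.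
Proof.
have B : bilin (koszul (fun xi eta => ev (brd xi eta) x)).
  case: brd_bilin => b1 b2; apply: bilin_koszul; split=> [v|u] a p q.
    by rewrite (b1 v a); exact: (bilin_ev V).1.
  by rewrite (b2 u a); exact: (bilin_ev V).1.
rewrite /ev /coadstar bidual_invE lin_lfunE // => a p q.
by rewrite (B.2 xi a) opprD scalerN.
Qed.

Lemma coadstar_ext (x y : V) :
  (forall eta : dual V, ev eta x = ev eta y) -> x = y.
Proof.
move=> h; apply/eqP; rewrite -subr_eq0; apply/eqP/fun_sep=> f.
by rewrite linearB /=; have := h f; rewrite /ev => ->; rewrite subrr.
Qed.

Lemma bilin_coadstar : bilin (coadstar brd).
Proof.
have B z : bilin (koszul (fun xi eta => ev (brd xi eta) z)).
  case: brd_bilin => b1 b2; apply: bilin_koszul; split=> [v|u] a p q.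
    by rewrite (b1 v a); exact: (bilin_ev V).1.
  by rewrite (b2 u a); exact: (bilin_ev V).1.
split=> [x|xi] a u v; apply: coadstar_ext => eta.
  case: (linear_props ((bilin_ev V).2 eta)) => _ D _ Z.
  by rewrite D Z !coadstarE ((B x).1 eta a) opprD scalerN.
case: (linear_props ((bilin_ev V).2 eta)) => _ D _ Z.
rewrite D Z !coadstarE scalerN -opprD; congr (- _).
rewrite scaler_sumr -big_split; apply: eq_bigr => i _ /=.
rewrite scaler_sumr -big_split; apply: eq_bigr => j _ /=.
by rewrite ((bilin_ev V).2 _ a) scalerDr !scalerA mulrC.
Qed.

(* <ad_xi eta, x> = - (-1)^{|xi||eta|} <eta, ad^*_xi x> *)
Lemma coadstarP i j xi eta x :
  xi \in spart (dual V) i -> eta \in spart (dual V) j ->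
  ev (brd xi eta) x = - ((-1) ^+ (i && j) * ev eta (coadstar brd xi x)).
Proof.
move=> xii etaj; rewrite coadstarE.
rewrite (koszul_hom (F := fun xi eta => ev (brd xi eta) x) _ xii etaj).
  by rewrite mulrN opprK mulrA -signr_addb addbb mul1r.
case: brd_bilin => b1 b2; split=> [v|u] a p q.
  by rewrite (b1 v a); exact: (bilin_ev V).1.
by rewrite (b2 u a); exact: (bilin_ev V).1.
Qed.

Lemma Delta_wedge x xi eta :
  super_skew brd -> Delta brd x (wedge xi eta) = coev x (brd xi eta).
Proof.
move=> sk; case: brd_bilin => b1 b2; apply: ext2_lift_wedge.
  split=> [v|u] a p q; rewrite ?(b1 v a) ?(b2 u a); exact: (bilin_coev V).2.
move=> i j a b ai bj; rewrite (sk i j a b ai bj).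
by case: (linear_props ((bilin_coev V).2 x)) => _ _ -> ->.
Qed.
End Cobracket.

Section Action.
Variables (V W : superspace K) (a : V -> W -> W) (al : 'End(W)).
Hypothesis a_bilin : bilin a.
Hypothesis a_even : forall i j x u, x \in spart V i -> u \in spart W j ->
  a x u \in spart W (i (+) j).
Hypothesis al_even : forall i u, u \in spart W i -> al u \in spart W i.

Let F x u v : ext2v W :=
  wedge (a x u) (al v) + koszul (fun x u => wedge (al u) (a x v)) x u.

Let bilin_xu v : bilin (fun x u => wedge (al u) (a x v)).
Proof.
case: a_bilin => a1 a2; split=> [u|x] c p q.
  by rewrite (a1 v c); exact: (bilin_wedge W).2.
by rewrite linearP; exact: (bilin_wedge W).1.
Qed.

Let bilin_F x : bilin (F x).
Proof.
case: a_bilin => a1 a2; have [w1 w2] := bilin_wedge W.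
split=> [v|u] c p q; rewrite /F.
  rewrite (a2 x c) (w1 _ c) ((bilin_koszul (bilin_xu v)).2 x c) /=.
  by rewrite scalerDr addrACA.
rewrite linearP (w2 _ c) /= scalerDr addrACA; congr (_ + _).
rewrite scaler_sumr -big_split; apply: eq_bigr => i _ /=.
rewrite scaler_sumr -big_split; apply: eq_bigr => j _ /=.
by rewrite (a2 _ c) (w2 _ c) scalerDr !scalerA mulrC.
Qed.

Let lin_F u v : linear (fun x => F x u v).
Proof.
case: a_bilin => a1 a2; have [w1 w2] := bilin_wedge W.
move=> c p q; rewrite /F (a1 u c) (w1 _ c) ((bilin_koszul (bilin_xu v)).1 u c) /=.
by rewrite scalerDr addrACA.
Qed.

Let F_hom i j x u v : x \in spart V i -> u \in spart W j ->
  F x u v = wedge (a x u) (al v) + (-1) ^+ (i && j) *: wedge (al u) (a x v).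
Proof. by move=> xi uj; rewrite /F (koszul_hom (bilin_xu v) xi uj). Qed.

Let skew_F x : super_skew (F x).
Proof.
move=> i j u v ui vj.
suff key k y : y \in spart V k -> F y u v = - ((-1) ^+ (i && j) *: F y v u).
  rewrite (hproj_decomp x).
  case: (linear_props (lin_F u v)) => _ -> _ _.
  case: (linear_props (lin_F v u)) => _ -> _ _.
  by rewrite scalerDr opprD !(key _ _ (hproj_mem _ _)).
move=> yk; rewrite (F_hom v yk ui) (F_hom u yk vj).
rewrite (wedge_skew (a_even yk ui) (al_even vj)).
rewrite (wedge_skew (al_even ui) (a_even yk vj)).
rewrite scalerDr opprD addrC; congr (_ + _).
  rewrite scalerN scalerA -signr_addb; congr (- (_ ^+ _ *: _)).
  by case: i j k {ui vj yk} => [] [] [].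
rewrite scalerA -signr_addb; congr (- (_ ^+ _ *: _)).
by case: i j k {ui vj yk} => [] [] [].
Qed.

Lemma ext2_act_wedge i j x u v : x \in spart V i -> u \in spart W j ->
  ext2_act a al x (wedge u v) =
  wedge (a x u) (al v) + (-1) ^+ (i && j) *: wedge (al u) (a x v).
Proof.
move=> xi uj; rewrite -(F_hom v xi uj) /ext2_act.
exact: (ext2_lift_wedge (F := F x)).
Qed.

Lemma linear_ext2_act : linear (ext2_act a al).
Proof.
move=> c x y; apply: ext2_lift_unique => u v.
rewrite add_lfunE scale_lfunE.
by rewrite !(ext2_lift_wedge (bilin_F _) (@skew_F _)) lin_F.
Qed.
End Action.

Lemma wedge_even W i j (u v : W) : u \in spart W i -> v \in spart W j ->
  (wedge u v : ext2 W) \in spart (ext2 W) (i (+) j).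
Proof.
move=> ui vj; rewrite /= limg_idem; last exact: ext2_proj_id.
have [w1 w2] := bilin_wedge W.
rewrite ext2_projE (bigD1 i) //= big1 ?addr0 => [|k ki].
  by rewrite addbAC addbb addFb !hproj_id.
by rewrite (hproj_neq ui ki); case: (linear_props (w1 (hproj W (i (+) j (+) k) v))) => ->.
Qed.

Section Double.
Variables (g : superspace K) (br : g -> g -> g)
  (brd : dual g -> dual g -> dual g).
Hypotheses (br_bilin : bilin br) (brd_bilin : bilin brd).

(* The bracket of the double on homogeneous x + xi and y + eta. *)
Lemma double_bracketE i j (x y : g) (xi eta : dual g) :
  x \in spart g i -> xi \in spart (dual g) i ->
  y \in spart g j -> eta \in spart (dual g) j ->
  double_bracket br brd (x, xi) (y, eta) =
  (br x y + coadstar brd xi y - (-1) ^+ (i && j) *: coadstar brd eta x,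
   brd xi eta + adstar br x eta - (-1) ^+ (i && j) *: adstar br y xi).
Proof.
move=> xi' xii yj etaj; rewrite /double_bracket.
rewrite (koszul_hom (bilin_flip (bilin_coadstar brd_bilin)) xi' etaj).
by rewrite (koszul_hom (bilin_flip (bilin_adstar br_bilin)) xii yj).
Qed.
End Double.

Lemma dsum_inlE V W (x : V) : dsum_inl V W x = (x, 0) :> V * W.
Proof. by rewrite lin_lfunE // => a u v; congr (_, _); rewrite /= scaler0 addr0. Qed.

Lemma dsum_inrE V W (y : W) : dsum_inr V W y = (0, y) :> V * W.
Proof. by rewrite lin_lfunE // => a u v; congr (_, _); rewrite /= scaler0 addr0. Qed.

Lemma dsum_mapE V W (f : 'End(V)) (h : 'End(W)) (u : V * W) :
  dsum_map f h u = (f u.1, h u.2) :> V * W.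
Proof. by rewrite lin_lfunE // => a v w; rewrite /= !linearP. Qed.

End HomLieFacts.

(* Main.v *)
(* Write M = g + g^* with bracket B, twist phi and form S. As S is nondegenerate,
   the Jacobi identity for homogeneous u, v, w, each in g or in g^*, may be tested
   by pairing its left-hand side J(u, v, w) with t in g or g^*. If u, v, w lie in
   the same summand, it vanishes by isotropy or by the given Jacobi identity.
   Otherwise, J being cyclic, u and v lie in one summand and w in the other.
   If t is in the summand of u and v, moving w out by invariance of S leaves the
   Jacobi identity of that summand at (phi u, phi v, t); if t is in the summand of
   w, it leaves (C1) or (C2). The powers of phi match thanks to admissibility,
   which gives [phi x, z] = phi [x, phi z] inside a summand and, by duality, the
   analogous rules for the coadjoint actions. *)

Require Import Defs.
From HB Require Import structures.
From mathcomp Require Import all_boot all_order all_algebra.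
From mathcomp Require Import ring.

Set Implicit Arguments.
Unset Strict Implicit.
Unset Printing Implicit Defensive.

Import GRing.Theory.
Local Open Scope ring_scope.

(** * Homogeneous elements and the Hom-Jacobi expression *)

Lemma homogeneous_ind (K : fieldType) (V : superspace K) (P : V -> Prop) :
  (forall x y, P x -> P y -> P (x + y)) ->
  (forall i x, x \in spart V i -> P x) -> forall x, P x.
Proof.
move=> PD Ph x; rewrite (hproj_decomp x).
by apply: PD; apply: Ph; exact: hproj_mem.
Qed.

(** The parities are arguments separate from the vectors, so that with the signs fixed the
    expression makes sense and is additive for all vectors. *)
Definition hom_jacobiator (K : fieldType) (V : superspace K) (br : V -> V -> V)
    (al : 'End(V)) (i j k : bool) (x y z : V) : V :=
  (-1) ^+ (i && k) *: br (al x) (br y z)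
  + (-1) ^+ (k && j) *: br (al z) (br x y)
  + (-1) ^+ (j && i) *: br (al y) (br z x).

(** * The Jacobi identity on a space split into two isotropic summands *)

Section IsotropicSplitting.
Variables (K : fieldType) (M : superspace K) (B : M -> M -> M).
Variables (phi : 'End(M)) (S : M -> M -> K) (p : bool -> M -> M).

Hypothesis B_bilin : bilin B.
Hypothesis B_even : forall i j x y, x \in spart M i -> y \in spart M j ->
  B x y \in spart M (i (+) j).
Hypothesis B_skew : super_skew B.
Hypothesis phi_even : forall i x, x \in spart M i -> phi x \in spart M i.
Hypothesis S_bilin : bilin (S : M -> M -> K^o).
Hypothesis S_nondeg : forall v, (forall w, S v w = 0) -> v = 0.
Hypothesis S_sym : forall i j v w, v \in spart M i -> w \in spart M j ->
  S v w = (-1) ^+ (i && j) * S w v.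
Hypothesis S_inv : forall x y z, S (B x y) z = S x (B y z).
Hypothesis S_phi : forall x y, S (phi x) y = S x (phi y).
Hypothesis p_even : forall c i x, x \in spart M i -> p c x \in spart M i.
Hypothesis p_add : forall c x, x = p c x + p (~~ c) x.

(** Membership in the summand [c]. Naming the summands by booleans makes [~~ c] the opposite one, so
    each argument serves for both at once. *)
Local Notation G c x := (p c x = x).

Hypothesis p_id : forall c x, G c (p c x).
Hypothesis S_iso : forall c x y, G c x -> G c y -> S x y = 0.
Hypothesis B_closed : forall c x y, G c x -> G c y -> G c (B x y).
Hypothesis phi_closed : forall c x, G c x -> G c (phi x).
Hypothesis B_mult : forall c x y, G c x -> G c y -> phi (B x y) = B (phi x) (phi y).
Hypothesis B_adm : forall c x y, G c x -> G c y -> B (phi (phi x)) (phi y) = B x (phi y).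

Local Notation jac := (hom_jacobiator B phi).

Hypothesis B_jac : forall c i j k x y z, G c x -> G c y -> G c z ->
  x \in spart M i -> y \in spart M j -> z \in spart M k -> jac i j k x y z = 0.

(* Condition (C1) for [c = false] and (C2) for [c = true], read in the double. *)
Hypothesis B_compat : forall c i j k l x y xi eta,
  G c x -> G c y -> G (~~ c) xi -> G (~~ c) eta ->
  x \in spart M i -> y \in spart M j -> xi \in spart M k -> eta \in spart M l ->
  S (B x y) (B (phi xi) eta) =
    - ((-1) ^+ (i && j) * (S y (B (p (~~ c) (B (phi x) (phi xi))) (phi eta))
      + (-1) ^+ (i && k) * S y (B (phi (phi xi)) (p (~~ c) (B (phi x) eta)))))
    + (S x (B (p (~~ c) (B (phi y) (phi xi))) (phi eta))
      + (-1) ^+ (j && k) * S x (B (phi (phi xi)) (p (~~ c) (B (phi y) eta)))).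

Let SDl z : {morph S^~ z : x y / x + y}.
Proof. by case: (linear_props (S_bilin.1 z)). Qed.
Let SNl z : {morph S^~ z : x / - x}.
Proof. by case: (linear_props (S_bilin.1 z)). Qed.
Let SZl z a x : S (a *: x) z = a * S x z.
Proof. by case: (linear_props (S_bilin.1 z)) => _ _ _ ->. Qed.
Let SDr z : {morph S z : x y / x + y}.
Proof. by case: (linear_props (S_bilin.2 z)). Qed.
Let SNr z : {morph S z : x / - x}.
Proof. by case: (linear_props (S_bilin.2 z)). Qed.
Let SZr z a x : S z (a *: x) = a * S z x.
Proof. by case: (linear_props (S_bilin.2 z)) => _ _ _ ->. Qed.
Let S0l z : S 0 z = 0.
Proof. by case: (linear_props (S_bilin.1 z)). Qed.
Let S0r z : S z 0 = 0.
Proof. by case: (linear_props (S_bilin.2 z)). Qed.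
Let SlinE := (SDl, SNl, SZl, SDr, SNr, SZr).

Let BDl z : {morph B^~ z : x y / x + y}.
Proof. by case: (linear_props (B_bilin.1 z)). Qed.
Let BDr z : {morph B z : x y / x + y}.
Proof. by case: (linear_props (B_bilin.2 z)). Qed.
Let BNr z : {morph B z : x / - x}.
Proof. by case: (linear_props (B_bilin.2 z)). Qed.
Let BZr z a x : B z (a *: x) = a *: B z x.
Proof. by case: (linear_props (B_bilin.2 z)) => _ _ _ ->. Qed.

(** A test vector splits into its two components. Isotropy makes the component in the summand of [v]
    and [w] invisible, so nondegeneracy of [S] needs only the other one. *)
Lemma isotropic_sep c v w : G c v -> G c w ->
  (forall l z, z \in spart M l -> G (~~ c) z -> S v z = S w z) -> v = w.
Proof.
move=> vc wc h; apply/eqP; rewrite -subr_eq0; apply/eqP/S_nondeg => z.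
elim/homogeneous_ind: z => [x y Sx Sy|l z zl]; first by rewrite SDr Sx Sy addr0.
rewrite SDl SNl (p_add c z) !SDr (h _ _ (p_even (~~ c) zl)) //.
by rewrite (S_iso vc (p_id _ _)) (S_iso wc (p_id _ _)) subrr.
Qed.

Lemma pair_projl c u z : G (~~ c) z -> S (p c u) z = S u z.
Proof. by move=> zc; rewrite {2}(p_add c u) SDl (S_iso (c := ~~ c) (p_id _ _)) ?addr0. Qed.

Lemma pair_projr c u z : G (~~ c) z -> S z (p c u) = S z u.
Proof. by move=> zc; rewrite {2}(p_add c u) SDr (S_iso (c := ~~ c) zc (p_id _ _)) addr0. Qed.

Lemma pair_act i k x xi z : x \in spart M i -> xi \in spart M k ->
  S (B x xi) z = - ((-1) ^+ (i && k) * S xi (B x z)).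
Proof. by move=> xi' xik; rewrite (B_skew xi' xik) SNl SZl S_inv. Qed.

(** Multiplicativity turns the right side into [B (phi x) (phi (phi z))]. Skew-symmetry brings the
    double twist to the left slot, where admissibility removes it. *)
Lemma adm_twist c x z : G c x -> G c z ->
  forall i j, x \in spart M i -> z \in spart M j ->
  B (phi x) z = phi (B x (phi z)).
Proof.
move=> xc zc i j xi zj; rewrite (B_mult xc) ?phi_closed //.
rewrite (B_skew (phi_even xi) zj) (B_skew (phi_even xi) (phi_even (phi_even zj))).
by rewrite (B_adm zc xc).
Qed.

(** Admissibility needs a right argument in the image of [phi]; [adm_twist] shows that the inner
    bracket is one. *)
Lemma adm_twist2 c x y z : G c x -> G c y -> G c z ->
  forall j l, y \in spart M j -> z \in spart M l ->
  B (phi (phi x)) (B (phi y) z) = B x (B (phi y) z).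
Proof.
move=> xc yc zc j l yj zl; rewrite (adm_twist yc zc yj zl) (B_adm xc) //.
by apply: B_closed => //; exact: phi_closed.
Qed.

(** The transpose of [adm_twist]: pairing with [z] in the summand [c] moves both the action of [x]
    and the twist over to [z]. *)
Lemma coadjoint_twist c i k x xi : G c x -> G (~~ c) xi ->
  x \in spart M i -> xi \in spart M k ->
  p (~~ c) (B (phi x) xi) = phi (p (~~ c) (B x (phi xi))).
Proof.
move=> xc xic xi' xik; apply: (isotropic_sep (c := ~~ c)) => // [|l z zl].
  exact: phi_closed.
rewrite negbK => zc; rewrite S_phi !pair_projl ?negbK //; last exact: phi_closed.
rewrite (pair_act _ (phi_even xi') xik) (pair_act _ xi' (phi_even xik)) S_phi.
by rewrite (adm_twist xc zc xi' zl).
Qed.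

(** Paired with [z], the two sides become [B x (phi z)] and [B (phi (phi x)) (phi z)] against [xi];
    admissibility identifies them. *)
Lemma coadjoint_mult c i k x xi : G c x -> G (~~ c) xi ->
  x \in spart M i -> xi \in spart M k ->
  phi (p (~~ c) (B x xi)) = p (~~ c) (B (phi x) (phi xi)).
Proof.
move=> xc xic xi' xik; apply: (isotropic_sep (c := ~~ c)) => // [|l z zl].
  exact: phi_closed.
rewrite negbK => zc; rewrite S_phi !pair_projl ?negbK //; last exact: phi_closed.
rewrite (pair_act _ xi' xik) (pair_act _ (phi_even xi') (phi_even xik)) S_phi.
by rewrite (B_mult (phi_closed xc) zc) (B_adm xc).
Qed.

Lemma jac_same_other c i j k l x y xi z :
  G c x -> G c y -> G (~~ c) xi -> G c z ->
  x \in spart M i -> y \in spart M j -> xi \in spart M k -> z \in spart M l ->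
  S (jac i j k x y xi) z = 0.
Proof.
move=> xc yc xic zc xi' yj xik zl; have [fx fy] := (phi_closed xc, phi_closed yc).
have [fxi fyj] := (phi_even xi', phi_even yj).
have /(congr1 (S xi)) := B_jac fx fy zc fxi fyj zl; rewrite /hom_jacobiator.
have fBxy := phi_even (B_even xi' yj).
(* The terms of this Jacobi identity carry more twists than the pairings [E1], [E2] and [E3] below.
   Multiplicativity and admissibility remove the surplus. *)
have -> : B (phi z) (B (phi x) (phi y)) =
    - ((-1) ^+ (l && (i (+) j)) *: phi (B (B x y) z)).
  by rewrite (B_mult _ zc) ?B_closed // -(B_mult xc yc) (B_skew (phi_even zl) fBxy).
have -> : B (phi (phi y)) (B z (phi x)) = - ((-1) ^+ (l && i) *: B y (B (phi x) z)).
  by rewrite (B_skew zl fxi) BNr BZr (adm_twist2 yc xc zc xi' zl).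
rewrite (adm_twist2 xc yc zc yj zl) !SlinE => J.
have E1 : S (B (phi x) (B y xi)) z =
    (-1) ^+ (i && (j (+) k)) * (-1) ^+ (j && k) * S xi (B y (B (phi x) z)).
  rewrite (pair_act _ fxi (B_even yj xik)) (pair_act _ yj xik); ring.
have E2 : S (B (phi xi) (B x y)) z = S xi (phi (B (B x y) z)).
  by rewrite S_inv S_phi.
have E3 : S (B (phi y) (B xi x)) z =
    - ((-1) ^+ (j && (k (+) i)) * S xi (B x (B (phi y) z))).
  by rewrite (pair_act _ fyj (B_even xik xi')) S_inv.
rewrite E1 E2 E3.
(* The pairing is the Jacobi sum in [J] up to this common sign. Zero is written with [S xi 0], the
   right side of [J], so that rewriting backwards brings the sum in. *)
transitivity (- ((-1) ^+ ((i && l) (+) (j && k)) * S xi 0)); last by rewrite S0r mulr0 oppr0.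
rewrite -J.
by case: i j k l {xi' yj xik zl fxi fyj fBxy J E1 E2 E3} => [] [] [] [] /=; ring.
Qed.

Lemma jac_cross c i j k l x y xi eta :
  G c x -> G c y -> G (~~ c) xi -> G (~~ c) eta ->
  x \in spart M i -> y \in spart M j -> xi \in spart M k -> eta \in spart M l ->
  S (jac i j k x y xi) eta = 0.
Proof.
move=> xc yc xic etac xi' yj xik etal.
(* The bracket of [phi u] with [eta] has a component in each summand. The two components give two
   terms, so [H] at [(x, y)] and at [(y, x)] gives the four terms on the right of [B_compat]. *)
have H a b u v : G c u -> G c v -> u \in spart M a -> v \in spart M b ->
    S (B (phi u) (B v xi)) eta = - ((-1) ^+ (a && (b (+) k)) *
      (S v (B (phi (phi xi)) (p (~~ c) (B (phi u) eta)))
       - (-1) ^+ ((b (+) k) && (a (+) l)) * (-1) ^+ (l && (b (+) k)) *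
         S u (B (p (~~ c) (B (phi v) (phi xi))) (phi eta)))).
  move=> uc vc ua vb; have fua := phi_even ua.
  have vxi := B_even vb xik; have ueta := B_even fua etal.
  have [vx ux] := (phi_closed vc, phi_closed uc).
  rewrite (pair_act _ fua vxi); congr (- (_ * _)).
  set W := B (phi u) eta; set Q := p (~~ c) (B v xi).
  have Qc : G (~~ c) Q by exact: p_id.
  have vxi' : Q \in spart M (b (+) k) by exact: p_even.
  rewrite {1}(p_add (~~ c) W) negbK SDr; congr (_ + _).
    (* [coadjoint_twist] exhibits the component as an image of [phi], so admissibility accounts for
       the double twist on [xi]. *)
    by rewrite S_inv /W (coadjoint_twist uc etac ua etal) (B_adm xic).
  (* Against [p c W] only the component [Q] of [B v xi] counts, and [Q] in turn pairs with [W] as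
     with [p c W]. *)
  have -> : S (B v xi) (p c W) = S Q W.
    by rewrite -(pair_projr W Qc) pair_projl // negbK.
  (* Symmetry and invariance isolate [phi u]; its twist passes to [B eta Q], where it is distributed
     over [eta] and [Q]. *)
  rewrite (S_sym vxi' ueta) S_inv S_phi (B_mult etac Qc) /Q.
  rewrite (coadjoint_mult vc xic vb xik).
  have pv := p_even (~~ c) (B_even (phi_even vb) (phi_even xik)).
  rewrite (B_skew (phi_even etal) pv).
  by rewrite SNr SZr mulrN mulrA.
(* The middle term of the jacobiator is the left side of [B_compat] up to sign; the last one becomes
   an instance of [H] once [B xi x] is reversed. *)
have E2 : S (B (phi xi) (B x y)) eta =
    - ((-1) ^+ (k && (i (+) j)) * S (B x y) (B (phi xi) eta)).
  by rewrite (pair_act _ (phi_even xik) (B_even xi' yj)).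
have E3 : S (B (phi y) (B xi x)) eta =
    - ((-1) ^+ (k && i) * S (B (phi y) (B x xi)) eta).
  by rewrite (B_skew xik xi') BNr BZr !SlinE.
rewrite /hom_jacobiator !SlinE E2 E3 (H _ _ _ _ xc yc xi' yj) (H _ _ _ _ yc xc yj xi').
rewrite (B_compat xc yc xic etac xi' yj xik etal).
case: i j k l {xi' yj xik etal H E2 E3} => [] [] [] [] /=; ring.
Qed.

(** * Reduction of the Jacobi identity to the split cases *)

Lemma jac_cycle i j k x y z : jac i j k x y z = jac j k i y z x.
Proof. by rewrite /hom_jacobiator addrC addrA andbC (andbC k) (andbC i). Qed.

Lemma jacDl i j k x x' y z : jac i j k (x + x') y z = jac i j k x y z + jac i j k x' y z.
Proof.
rewrite /hom_jacobiator linearD !BDl !BDr !scalerDr !addrA.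
by rewrite [LHS](ACl (1*3*5*2*4*6)).
Qed.

Lemma splitting_jac_two c d i j k l x y z t :
  G c x -> G c y -> G (~~ c) z -> G d t ->
  x \in spart M i -> y \in spart M j -> z \in spart M k -> t \in spart M l ->
  S (jac i j k x y z) t = 0.
Proof.
move=> xc yc zc td xi yj zk tl; case: (boolP (d == c)) => [/eqP dc|dc].
  by rewrite dc in td; exact: (jac_same_other xc yc zc td xi yj zk tl).
have {}dc : d = ~~ c by case: (c) (d) dc => [] [].
by rewrite dc in td; exact: (jac_cross xc yc zc td xi yj zk tl).
Qed.

Lemma splitting_jac_hom a b c i j k x y z : G a x -> G b y -> G c z ->
  x \in spart M i -> y \in spart M j -> z \in spart M k -> jac i j k x y z = 0.
Proof.
move=> xa yb zc xi yj zk; apply: S_nondeg.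
apply: homogeneous_ind => [t t' St St'|l t tl]; first by rewrite SDr St St' addr0.
rewrite (p_add false t) SDr.
suff key d : S (jac i j k x y z) (p d t) = 0 by rewrite !key addr0.
have [td tdl] := (p_id d t, p_even d tl).
case: (boolP (a == b)) => [/eqP ab|ab].
  case: (boolP (c == b)) => [/eqP cb|cb].
    by rewrite -ab in cb yb; rewrite cb in zc; rewrite (B_jac xa yb zc) // S0l.
  have cb' : c = ~~ a by rewrite ab; case: (c) (b) cb => [] [].
  by rewrite -ab in yb; rewrite cb' in zc; exact: (splitting_jac_two xa yb zc td xi yj zk tdl).
have ab' : b = ~~ a by move: ab; case: (a); case: (b).
rewrite ab' in yb; case: (boolP (c == a)) => [/eqP ca|ca].
  by rewrite ca in zc; rewrite -jac_cycle; exact: (splitting_jac_two zc xa yb td zk xi yj tdl).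
have ca' : c = ~~ a by case: (a) (c) ca => [] [].
(* Here [y] and [z] share the summand [~~ a], and [x] lies in its opposite, read as [~~ ~~ a]. *)
rewrite ca' in zc; rewrite jac_cycle; rewrite -(negbK a) in xa.
exact: (splitting_jac_two yb zc xa td yj zk xi tdl).
Qed.

(** Additivity in the first slot is enough: cycling brings each vector there in turn to be split. *)
Lemma splitting_jacobi i j k x y z :
  x \in spart M i -> y \in spart M j -> z \in spart M k -> jac i j k x y z = 0.
Proof.
move=> xi yj zk; rewrite (p_add false x) jacDl.
suff keyx a : jac i j k (p a x) y z = 0 by rewrite !keyx addr0.
rewrite jac_cycle (p_add false y) jacDl.
suff keyy b : jac j k i (p b y) z (p a x) = 0 by rewrite !keyy addr0.
rewrite jac_cycle (p_add false z) jacDl.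
suff keyz c : jac k i j (p c z) (p a x) (p b y) = 0 by rewrite !keyz addr0.
by apply: (splitting_jac_hom (a := c) (b := a) (c := b)); rewrite ?p_id //; exact: p_even.
Qed.

End IsotropicSplitting.

(** * Signs, parity and nondegeneracy of the pairing *)

Section Pairing.
Variables (K : fieldType) (V : superspace K).

Lemma ev_parity i j (x : V) (xi : dual V) :
  x \in spart V i -> xi \in spart (dual V) j -> i != j -> ev xi x = 0.
Proof.
move=> xV /dual_partP xi0 ij; apply: xi0.
by have -> : ~~ j = i by case: (i) (j) ij => [] [].
Qed.

Lemma coevDl (xi : dual V) : {morph (fun x => coev x xi) : x y / x + y}.
Proof. by case: (linear_props ((bilin_coev V).1 xi)). Qed.
Lemma coevDr (x : V) : {morph coev x : x y / x + y}.
Proof. by case: (linear_props ((bilin_coev V).2 x)). Qed.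
Lemma evDr (xi : dual V) : {morph ev xi : x y / x + y}.
Proof. by case: (linear_props ((bilin_ev V).2 xi)). Qed.
Lemma evDl (x : V) : {morph (fun xi : dual V => ev xi x) : x y / x + y}.
Proof. by case: (linear_props ((bilin_ev V).1 x)). Qed.
Lemma evNr (xi : dual V) : {morph ev xi : x / - x}.
Proof. by case: (linear_props ((bilin_ev V).2 xi)). Qed.
Lemma evZr (xi : dual V) a x : ev xi (a *: x) = a * ev xi x.
Proof. by case: (linear_props ((bilin_ev V).2 xi)) => _ _ _ ->. Qed.
Lemma evNl (x : V) : {morph (fun xi : dual V => ev xi x) : x / - x}.
Proof. by case: (linear_props ((bilin_ev V).1 x)). Qed.
Lemma evZl (xi : dual V) a (x : V) : ev (a *: xi) x = a * ev xi x.
Proof. by case: (linear_props ((bilin_ev V).1 x)) => _ _ _ ->. Qed.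
Lemma coevNl (xi : dual V) : {morph (fun x => coev x xi) : x / - x}.
Proof. by case: (linear_props ((bilin_coev V).1 xi)). Qed.
Lemma coevZl (xi : dual V) a x : coev (a *: x) xi = a * coev x xi.
Proof. by case: (linear_props ((bilin_coev V).1 xi)) => _ _ _ ->. Qed.
Lemma coevNr (x : V) : {morph coev x : x / - x}.
Proof. by case: (linear_props ((bilin_coev V).2 x)). Qed.
Lemma coevZr (x : V) a xi : coev x (a *: xi) = a * coev x xi.
Proof. by case: (linear_props ((bilin_coev V).2 x)) => _ _ _ ->. Qed.
Lemma ev0l (x : V) : ev (0 : dual V) x = 0.
Proof. by case: (linear_props ((bilin_ev V).1 x)). Qed.
Lemma ev0r (xi : dual V) : ev xi 0 = 0.
Proof. by case: (linear_props ((bilin_ev V).2 xi)). Qed.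
Lemma coev0l (xi : dual V) : coev 0 xi = 0.
Proof. by case: (linear_props ((bilin_coev V).1 xi)). Qed.
Lemma coev0r (x : V) : coev x 0 = 0.
Proof. by case: (linear_props ((bilin_coev V).2 x)). Qed.

(** Vectors and forms of different parities pair to zero, so the Koszul sign depends on the form
    alone and [x] may be inhomogeneous. *)
Lemma coev_sign j (x : V) (xi : dual V) :
  xi \in spart (dual V) j -> coev x xi = (-1) ^+ j * ev xi x.
Proof.
move=> xij; elim/homogeneous_ind: x => [x y Px Py|i x xV].
  by rewrite coevDl evDr Px Py mulrDr.
rewrite (coev_hom xV xij); case: (eqVneq i j) => [->|ij]; first by rewrite andbb.
by rewrite (ev_parity xV xij ij) !mulr0.
Qed.

Lemma coev_nondeg (x : V) : (forall xi, coev x xi = 0) -> x = 0.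
Proof.
move=> x0; apply: fun_sep; apply: (@homogeneous_ind _ (dual V)) => [f h f0 h0|j f fj].
  by rewrite add_lfunE f0 h0 addr0.
have := coev_sign x fj; rewrite x0 => /esym/eqP.
by rewrite mulf_eq0 signr_eq0 => /eqP.
Qed.

Lemma coev_dual_map (al : 'End(V)) x xi :
  (forall i x, x \in spart V i -> al x \in spart V i) ->
  coev (al x) xi = coev x (dual_map al xi).
Proof.
move=> al_even; elim/homogeneous_ind: xi => [f h f0 h0|j f fj].
  by rewrite linearD !coevDr f0 h0.
by rewrite (coev_sign _ fj) (coev_sign _ (dual_map_even al_even fj)) dual_mapE.
Qed.

Lemma spart_hproj (i : bool) (x : V) : hproj V (~~ i) x = 0 -> x \in spart V i.
Proof.
move=> x0; rewrite (hproj_decomp x).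
by case: i x0 => /= ->; rewrite ?addr0 ?add0r hproj_mem.
Qed.

Lemma ev_hproj i (xi : dual V) x : ev (hproj (dual V) i xi) x = ev xi (hproj V i x).
Proof.
have e : hproj (dual V) i xi = dual_proj V i xi by exact: hproj_of_proj.
by rewrite e /ev dual_projE comp_lfunE.
Qed.

(** The component of the wrong parity is tested against a form [eta]. The projection transposes to
    [eta], and the value becomes, up to sign, that of a bracket of forms at [x], zero by parity. *)
Lemma coadstar_even (brd : dual V -> dual V -> dual V) i j xi x :
  bilin brd ->
  (forall i j x y, x \in spart (dual V) i -> y \in spart (dual V) j ->
    brd x y \in spart (dual V) (i (+) j)) ->
  xi \in spart (dual V) i -> x \in spart V j -> coadstar brd xi x \in spart V (i (+) j).
Proof.
move=> b ev_b xii xj; apply: spart_hproj; apply: coadstar_ext => eta.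
rewrite ev0r; set k := ~~ _; have etak := @hproj_mem _ (dual V) k eta.
rewrite -ev_hproj.
have := coadstarP b x xii etak.
rewrite (ev_parity xj (ev_b _ _ _ _ xii etak)); last by rewrite /k; case: (i) (j) => [] [].
by move/esym/eqP; rewrite oppr_eq0 mulf_eq0 signr_eq0 => /eqP.
Qed.

(** Composed with the projection onto the other parity, [D] vanishes on all wedges, and a linear map
    on the exterior square is determined by its values there. *)
Lemma ext2_form_even (W : superspace K) (D : dual (ext2 W)) i :
  (forall j k u v, u \in spart W j -> v \in spart W k -> j (+) k != i ->
     ev D (wedge u v : ext2 W) = 0) ->
  D \in spart (dual (ext2 W)) i.
Proof.
move=> D0; apply/dual_partP => X; rewrite /= limg_idem; last exact: ext2_proj_id.
move/eqP <-; pose E : 'Hom(ext2v W, K^o) := D.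
have -> : ev D (ext2_proj W (~~ i) X) = (E \o ext2_proj W (~~ i))%VF X.
  by rewrite comp_lfunE.
have -> : (E \o ext2_proj W (~~ i) = 0)%VF.
  apply: ext2_lift_unique => u v; rewrite comp_lfunE zero_lfunE ext2_projE.
  rewrite linear_sum big1 // => j _.
  apply: (D0 _ _ _ _ (hproj_mem _ _) (hproj_mem _ _)).
  by case: (i) j => [] [].
by rewrite zero_lfunE.
Qed.

Lemma coadstar_hom (brd : dual V -> dual V -> dual V) i j xi eta x : bilin brd ->
  xi \in spart (dual V) i -> eta \in spart (dual V) j ->
  ev eta (coadstar brd xi x) = - ((-1) ^+ (i && j) * ev (brd xi eta) x).
Proof.
move=> b xii etaj; rewrite (coadstarP b x xii etaj).
by rewrite mulrN opprK mulrA -signr_addb addbb mul1r.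
Qed.

End Pairing.

(** * Bracket and form of the double *)

Section Double.
Variables (K : fieldType) (g : superspace K) (br : g -> g -> g).
Variables (brd : dual g -> dual g -> dual g) (al : 'End(g)).
Hypothesis g_hls : hom_lie_superalgebra br al.
Hypothesis gd_hls : hom_lie_superalgebra brd (dual_map al).

Local Notation M := (dsum g (dual g)).
Local Notation B := (double_bracket br brd).
Local Notation S := (@double_form K g).
Local Notation pr1 u := (u : g * dual g).1.
Local Notation pr2 u := (u : g * dual g).2.
Local Notation pair x xi := ((x, xi) : dsum g (dual g)).

Let br_bilin := hls_bilin g_hls.
Let brd_bilin := hls_bilin gd_hls.
Let br_even := hls_even g_hls.
Let brd_even := hls_even gd_hls.
Let al_even := hls_twist_even g_hls.
Let ald_even := hls_twist_even gd_hls.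

Lemma bilin_double_bracket : bilin B.
Proof.
have [a1 a2] := bilin_adstar br_bilin.
have [c1 c2] := bilin_coadstar brd_bilin.
have [ka1 ka2] := bilin_koszul (bilin_flip (conj a1 a2)).
have [kc1 kc2] := bilin_koszul (bilin_flip (conj c1 c2)).
have [b1 b2] := br_bilin; have [d1 d2] := brd_bilin.
split=> [[y eta]|[x xi]] a [u1 f1] [u2 f2]; congr (_, _); rewrite /=.
- rewrite (b1 y a) (c1 y a) (kc1 eta a) scalerBr scalerDr opprD.
  by rewrite !addrA [LHS](ACl (1*3*5*2*4*6)).
- rewrite (d1 eta a) (a1 eta a) (ka1 y a) scalerBr scalerDr opprD.
  by rewrite !addrA [LHS](ACl (1*3*5*2*4*6)).
- rewrite (b2 x a) (c2 xi a) (kc2 x a) scalerBr scalerDr opprD.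
  by rewrite !addrA [LHS](ACl (1*3*5*2*4*6)).
- rewrite (d2 xi a) (a2 x a) (ka2 xi a) scalerBr scalerDr opprD.
  by rewrite !addrA [LHS](ACl (1*3*5*2*4*6)).
Qed.

Lemma bilin_double_form : bilin (S : M -> M -> K^o).
Proof.
have [a1 a2] := bilin_coev g; have [b1 b2] := bilin_ev g.
split=> [[y eta]|[x xi]] a [u1 f1] [u2 f2] /=.
  by rewrite (a1 eta a) (b1 y a) /= scalerDr addrACA.
by rewrite (a2 x a) (b2 xi a) /= scalerDr addrACA.
Qed.

Lemma double_bracket_even i j u v : u \in spart M i -> v \in spart M j ->
  B u v \in spart M (i (+) j).
Proof.
case: u v => [x xi] [y eta].
rewrite dsum_partE => /andP[xi' xii]; rewrite dsum_partE => /andP[yj etaj].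
rewrite (double_bracketE br_bilin brd_bilin xi' xii yj etaj) dsum_partE.
have ca k l f z := @coadstar_even K g brd k l f z brd_bilin brd_even.
have aa k l z f := @adstar_even K g br br_bilin br_even k l z f.
apply/andP; split; apply: rpredB; try apply: rpredD; try apply: rpredZ.
- exact: br_even.
- exact: ca.
- by rewrite addbC; exact: ca.
- exact: brd_even.
- exact: aa.
- by rewrite addbC; exact: aa.
Qed.

Lemma double_bracket_skew : super_skew B.
Proof.
move=> i j [x xi] [y eta]; rewrite dsum_partE => /andP[xi' xii].
rewrite dsum_partE => /andP[yj etaj].
rewrite (double_bracketE br_bilin brd_bilin xi' xii yj etaj).
rewrite (double_bracketE br_bilin brd_bilin yj etaj xi' xii).
rewrite (hls_skew g_hls xi' yj) (hls_skew gd_hls xii etaj).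
by congr (_, _); rewrite /= (andbC j); case: (i && j);
  rewrite ?expr0 ?expr1 ?scale1r ?scaleN1r ?opprK ?opprD ?opprK // addrAC // addrA.
Qed.

Lemma double_form_sym i j u v : u \in spart M i -> v \in spart M j ->
  S u v = (-1) ^+ (i && j) * S v u.
Proof.
case: u v => [x xi] [y eta].
rewrite dsum_partE => /andP[xi' xii]; rewrite dsum_partE => /andP[yj etaj].
rewrite /= (coev_hom xi' etaj) (coev_hom yj xii).
by rewrite (andbC j) mulrDr mulrA -signr_addb addbb mul1r addrC.
Qed.

Lemma double_form_nondeg u : (forall v, S u v = 0) -> u = 0.
Proof.
case: u => x xi h; congr (_, _).
  by apply: coev_nondeg => eta; have := h (0, eta); rewrite /= ev0r addr0.
by apply/lfunP=> y; have := h (y, 0); rewrite /= coev0r add0r zero_lfunE.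
Qed.

Lemma double_form_twist u v :
  S (dsum_map al (dual_map al) u) v = S u (dsum_map al (dual_map al) v).
Proof.
case: u v => [x xi] [y eta]; rewrite [dsum_map _ _ (x, xi)]dsum_mapE.
rewrite [dsum_map _ _ (y, eta)]dsum_mapE /=.
by rewrite (coev_dual_map _ _ al_even) dual_mapE.
Qed.

(** On homogeneous vectors, the identities defining the two coadjoint maps turn each side into six
    terms: three forms evaluated at brackets of vectors and three brackets of forms evaluated at
    vectors. Only signs remain to be compared. *)
Lemma double_form_inv u v w : S (B u v) w = S u (B v w).
Proof.
have [B1 B2] := bilin_double_bracket; have [S1 S2] := bilin_double_form.
have SDl z : {morph S^~ z : x y / x + y} by case: (linear_props (S1 z)).
have SDr z : {morph S z : x y / x + y} by case: (linear_props (S2 z)).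
have BDl z : {morph B^~ z : x y / x + y} by case: (linear_props (B1 z)).
have BDr z : {morph B z : x y / x + y} by case: (linear_props (B2 z)).
elim/(@homogeneous_ind _ M): u => [u u' Pu Pu'|i u ui]; first by rewrite BDl !SDl Pu Pu'.
elim/(@homogeneous_ind _ M): v => [v v' Pu Pu'|j v vj]; first by rewrite BDl BDr SDl SDr Pu Pu'.
elim/(@homogeneous_ind _ M): w => [w w' Pu Pu'|k w wk]; first by rewrite BDr !SDr Pu Pu'.
case: u v w ui vj wk => [x xi] [y eta] [z zeta]; rewrite dsum_partE => /andP[xi' xii].
rewrite dsum_partE => /andP[yj etaj]; rewrite dsum_partE => /andP[zk zetak].
rewrite (double_bracketE br_bilin brd_bilin xi' xii yj etaj).
rewrite (double_bracketE br_bilin brd_bilin yj etaj zk zetak) /=.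
have cae k l f t := @coadstar_even K g brd k l f t brd_bilin brd_even.
(* An opaque copy, lest the additivity of [ev] rewrite under the definition. *)
have [A AE] : exists A, A = adstar br by eexists.
have aae k l t f := @adstar_even K g br br_bilin br_even k l t f.
rewrite -AE in aae *.
rewrite !(coevDl, coevNl, coevZl, coevDr, coevNr, coevZr).
rewrite !(evDl, evNl, evZl, evDr, evNr, evZr).
rewrite (coev_hom (br_even xi' yj) zetak) (coev_hom (cae _ _ _ _ xii yj) zetak).
rewrite (coev_hom (cae _ _ _ _ etaj xi') zetak).
rewrite (coev_hom xi' (brd_even etaj zetak)). rewrite (coev_hom xi' (aae _ _ _ _ yj zetak)).
rewrite (coev_hom xi' (aae _ _ _ _ zk etaj)).
rewrite AE (adstarE _ br_bilin xi' etaj) (adstarE _ br_bilin yj xii).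
rewrite (adstarE _ br_bilin yj zetak) (adstarE _ br_bilin zk etaj).
rewrite (coadstar_hom _ brd_bilin xii zetak) (coadstar_hom _ brd_bilin etaj zetak).
rewrite (coadstar_hom _ brd_bilin etaj xii) (coadstar_hom _ brd_bilin zetak xii).
(* Orient every bracket alike, so that the same six values occur on both sides. *)
rewrite (hls_skew g_hls yj xi') (hls_skew g_hls zk xi').
rewrite (hls_skew gd_hls etaj xii) (hls_skew gd_hls zetak xii).
rewrite !(evDl, evNl, evZl, evDr, evNr, evZr).
by case: (i) (j) (k) => [] [] [] /=; ring.
Qed.

Lemma double_bracket_inl x y : B (pair x 0) (pair y 0) = pair (br x y) 0.
Proof.
have [a1 a2] := bilin_adstar br_bilin.
have [c1 c2] := bilin_coadstar brd_bilin.
rewrite /double_bracket; congr (_, _).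
  have [_ k2] := bilin_koszul (bilin_flip (conj c1 c2)).
  case: (linear_props (c1 y)) => -> _ _ _; case: (linear_props (k2 x)) => -> _ _ _.
  by rewrite addr0 subr0.
have [k1 _] := bilin_koszul (bilin_flip (conj a1 a2)).
case: (linear_props (a2 x)) => -> _ _ _; case: (linear_props (k1 y)) => -> _ _ _.
by case: (linear_props (brd_bilin.1 0)) => -> _ _ _; rewrite addr0 subr0.
Qed.

Lemma double_bracket_inr xi eta : B (pair 0 xi) (pair 0 eta) = pair 0 (brd xi eta).
Proof.
have [a1 a2] := bilin_adstar br_bilin.
have [c1 c2] := bilin_coadstar brd_bilin.
rewrite /double_bracket; congr (_, _).
  have [k1 _] := bilin_koszul (bilin_flip (conj c1 c2)).
  case: (linear_props (c2 xi)) => -> _ _ _; case: (linear_props (k1 eta)) => -> _ _ _.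
  by case: (linear_props (br_bilin.1 0)) => -> _ _ _; rewrite addr0 subr0.
have [_ k2] := bilin_koszul (bilin_flip (conj a1 a2)).
case: (linear_props (a1 eta)) => -> _ _ _; case: (linear_props (k2 xi)) => -> _ _ _.
by rewrite addr0 subr0.
Qed.

(** Of this mixed bracket, (C1) involves only the component in the dual of [g], the coadjoint action
    of [x]. *)
Lemma double_bracket_inlr x eta : pr2 (B (pair x 0) (pair 0 eta)) = adstar br x eta.
Proof.
have [k1 k2] := bilin_koszul (bilin_flip (bilin_adstar br_bilin)).
rewrite /=; case: (linear_props (brd_bilin.1 eta)) => -> _ _ _.
by case: (linear_props (k1 0)) => -> _ _ _; rewrite add0r subr0.
Qed.

Lemma double_bracket_inrl xi y : pr1 (B (pair 0 xi) (pair y 0)) = coadstar brd xi y.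
Proof.
have [k1 k2] := bilin_koszul (bilin_flip (bilin_coadstar brd_bilin)).
rewrite /=; case: (linear_props (br_bilin.1 y)) => -> _ _ _.
by case: (linear_props (k1 0)) => -> _ _ _; rewrite add0r subr0.
Qed.

(** The contragredient action on [Delta brd x] carries a Koszul sign, and evaluating it requires
    this parity. *)
Lemma Delta_even i x : x \in spart g i ->
  Delta brd x \in spart (dual (ext2 (dual g))) i.
Proof.
move=> xi; apply: ext2_form_even => j k u v uj vk jk.
rewrite /ev (Delta_wedge brd_bilin) //; last exact: hls_skew gd_hls.
rewrite (coev_hom xi (brd_even uj vk)) (ev_parity xi (brd_even uj vk)) ?mulr0 //.
by rewrite eq_sym.
Qed.

Lemma Deltastar_even i xi : xi \in spart (dual g) i ->
  Deltastar br xi \in spart (dual (ext2 g)) i.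
Proof.
move=> xii; apply: ext2_form_even => j k u v uj vk jk.
rewrite /ev (Deltastar_wedge br_bilin) //; last exact: hls_skew g_hls.
by rewrite (ev_parity (br_even uj vk) xii).
Qed.

(** * The bialgebra conditions as identities between pairings *)

Hypothesis bialg : hom_lie_superbialgebra br brd al.

(** (C1) with the action moved onto the wedge, expanded by the Leibniz rule and evaluated through
    [Delta]. This is [B_compat] for [c = false], where [S] reduces to [coev]. *)
Lemma compat_pairing i j k l (x y : g) (xi eta : dual g) :
  x \in spart g i -> y \in spart g j ->
  xi \in spart (dual g) k -> eta \in spart (dual g) l ->
  coev (br x y) (brd (dual_map al xi) eta) =
    - ((-1) ^+ (i && j) *
       (coev y (brd (adstar br (al x) (dual_map al xi)) (dual_map al eta))
      + (-1) ^+ (i && k) *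
        coev y (brd (dual_map al (dual_map al xi)) (adstar br (al x) eta))))
    + (coev x (brd (adstar br (al y) (dual_map al xi)) (dual_map al eta))
      + (-1) ^+ (j && k) *
        coev x (brd (dual_map al (dual_map al xi)) (adstar br (al y) eta))).
Proof.
move=> xi' yj xik etal.
have sk : super_skew brd by exact: hls_skew gd_hls.
have aae k l t f := @adstar_even K g br br_bilin br_even k l t f.
have T a b u v : u \in spart g a -> v \in spart g b ->
    ev (ad2 br al (al u) (Delta brd v)) (wedge (dual_map al xi) eta : ext2 (dual g)) =
    - ((-1) ^+ (a && b) *
       (coev v (brd (adstar br (al u) (dual_map al xi)) (dual_map al eta))
      + (-1) ^+ (a && k) *
        coev v (brd (dual_map al (dual_map al xi)) (adstar br (al u) eta)))).
  move=> ua vb.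
  have L := linear_ext2_act (bilin_adstar br_bilin) aae ald_even.
  rewrite /ad2 (dual_actP _ L (al_even ua) (Delta_even vb)).
  rewrite (ext2_act_wedge (bilin_adstar br_bilin) aae ald_even _ (al_even ua) (ald_even xik)).
  by rewrite evDr evZr /ev !(Delta_wedge brd_bilin).
have E : ev (Delta brd (br x y)) (wedge (dual_map al xi) eta : ext2 (dual g)) =
    coev (br x y) (brd (dual_map al xi) eta).
  by exact: Delta_wedge brd_bilin (br x y) _ _ sk.
rewrite -E; apply: etrans (hlsb_compat bialg xi' yj xik etal) _.
congr (_ + _); first exact: T.
rewrite (T _ _ _ _ yj xi').
(* The sign in front of the second term of (C1) cancels against the Koszul sign of the
   contragredient action. *)
by rewrite (andbC j i) mulrN opprK mulrA -signr_addb addbb mul1r.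
Qed.

(** (C2) unfolded in the same way gives [B_compat] for [c = true], where the left arguments are
    forms and [S] reduces to [ev]. *)
Lemma cocompat_pairing i j k l (xi eta : dual g) (x y : g) :
  xi \in spart (dual g) i -> eta \in spart (dual g) j ->
  x \in spart g k -> y \in spart g l ->
  ev (brd xi eta) (br (al x) y) =
    - ((-1) ^+ (i && j) *
       (ev eta (br (coadstar brd (dual_map al xi) (al x)) (al y))
      + (-1) ^+ (i && k) *
        ev eta (br (al (al x)) (coadstar brd (dual_map al xi) y))))
    + (ev xi (br (coadstar brd (dual_map al eta) (al x)) (al y))
      + (-1) ^+ (j && k) *
        ev xi (br (al (al x)) (coadstar brd (dual_map al eta) y))).
Proof.
move=> xii etaj xk yl.
have sk : super_skew br by exact: hls_skew g_hls.
have cae k' l' f t := @coadstar_even K g brd k' l' f t brd_bilin brd_even.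
have T a b u v : u \in spart (dual g) a -> v \in spart (dual g) b ->
    ev (coad2 brd al (dual_map al u) (Deltastar br v)) (wedge (al x) y : ext2 g) =
    - ((-1) ^+ (a && b) *
       (ev v (br (coadstar brd (dual_map al u) (al x)) (al y))
      + (-1) ^+ (a && k) *
        ev v (br (al (al x)) (coadstar brd (dual_map al u) y)))).
  move=> ua vb.
  have L := linear_ext2_act (bilin_coadstar brd_bilin) cae al_even.
  rewrite /coad2 (dual_actP _ L (ald_even ua) (Deltastar_even vb)).
  rewrite (ext2_act_wedge (bilin_coadstar brd_bilin) cae al_even _ (ald_even ua) (al_even xk)).
  by rewrite evDr evZr /ev !(Deltastar_wedge br_bilin).
have E : ev (Deltastar br (brd xi eta)) (wedge (al x) y : ext2 g) =
    ev (brd xi eta) (br (al x) y).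
  by exact: Deltastar_wedge br_bilin _ _ _ sk.
rewrite -E; apply: etrans (hlsb_cocompat bialg xii etaj xk yl) _.
congr (_ + _); first exact: T.
rewrite (T _ _ _ _ etaj xii).
by rewrite (andbC j i) mulrN opprK mulrA -signr_addb addbb mul1r.
Qed.

(** * Jacobi identity of the double and the Manin supertriple *)

Hypothesis g_mult : hom_multiplicative br al.
Hypothesis gd_mult : hom_multiplicative brd (dual_map al).
Hypothesis g_adm : hom_admissible br al.
Hypothesis gd_adm : hom_admissible brd (dual_map al).

Lemma admissible_eq (V : superspace K) (b : V -> V -> V) (f : 'End(V)) x y :
  bilin b -> hom_admissible b f -> b (f (f x)) (f y) = b x (f y).
Proof.
move=> [b1 _] adm; have := adm x y; case: (linear_props (b1 (f y))) => _ D N _.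
by rewrite D N => /eqP; rewrite subr_eq0 => /eqP.
Qed.

Definition double_part (c : bool) (u : M) : M :=
  if c then pair 0 (pr2 u) else pair (pr1 u) 0.

Lemma double_partP c u : double_part c u = u ->
  if c then exists xi, u = pair 0 xi else exists x, u = pair x 0.
Proof. by case: c u => [] [x xi] /= [<-]; eexists. Qed.

Lemma double_jacobi i j k x y z :
  x \in spart M i -> y \in spart M j -> z \in spart M k ->
  hom_jacobiator B (dsum_map al (dual_map al)) i j k x y z = 0.
Proof.
have phiE u f : dsum_map al (dual_map al) (pair u f) = pair (al u) (dual_map al f).
  by rewrite dsum_mapE.
have phil u : dsum_map al (dual_map al) (pair u 0) = pair (al u) 0.
  by rewrite phiE linear0.
have phir f : dsum_map al (dual_map al) (pair 0 f) = pair 0 (dual_map al f).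
  by rewrite phiE linear0.
have ll := double_bracket_inl; have rr := double_bracket_inr.
have lr u f : double_part true (B (pair u 0) (pair 0 f)) = pair 0 (adstar br u f).
  by rewrite /double_part double_bracket_inlr.
have rl f u : double_part false (B (pair 0 f) (pair u 0)) = pair (coadstar brd f u) 0.
  by rewrite /double_part double_bracket_inrl.
apply: (@splitting_jacobi K M B (dsum_map al (dual_map al)) (S : M -> M -> K) double_part).
- exact: bilin_double_bracket.
- exact: double_bracket_even.
- exact: double_bracket_skew.
- move=> {}i [u f]; rewrite phiE !dsum_partE => /andP[ui fi].
  by rewrite al_even ?ald_even.
- exact: bilin_double_form.
- exact: double_form_nondeg.
- exact: double_form_sym.
- exact: double_form_inv.
- exact: double_form_twist.
(* From here on the goals concern the splitting by [double_part]: first the projections and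
   isotropy, then what the structures on the summands provide, last the compatibility. *)
- by case=> {}i [u f]; rewrite !dsum_partE => /andP[ui fi]; rewrite mem0v ?andbT.
- by case=> [] [u f]; congr (_, _); rewrite /= ?addr0 ?add0r.
- by case=> [] [u f].
- move=> [] u v /double_partP[u' ->] /double_partP[v' ->] /=.
    by rewrite coev0l ev0r addr0.
  by rewrite coev0r ev0l addr0.
- by move=> [] u v /double_partP[u' ->] /double_partP[v' ->]; rewrite ?ll ?rr.
- by move=> [] u /double_partP[u' ->]; rewrite ?phil ?phir.
- move=> [] u v /double_partP[u' ->] /double_partP[v' ->].
    by rewrite !rr !phir rr gd_mult.
  by rewrite !ll !phil ll g_mult.
- move=> [] u v /double_partP[u' ->] /double_partP[v' ->].
    by rewrite !phir !rr (admissible_eq _ _ brd_bilin gd_adm).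
  by rewrite !phil !ll (admissible_eq _ _ br_bilin g_adm).
- move=> [] {}i {}j {}k u v w /double_partP[u' ->] /double_partP[v' ->] /double_partP[w' ->].
    rewrite !dsum_partE !mem0v /= => ui vj wk; have J := hls_jacobi gd_hls ui vj wk.
    rewrite /hom_jacobiator !phir !rr; congr (_, _); last exact: J.
    by rewrite /= !scaler0 !addr0.
  rewrite !dsum_partE !mem0v !andbT => ui vj wk; have J := hls_jacobi g_hls ui vj wk.
  rewrite /hom_jacobiator !phil !ll; congr (_, _); first exact: J.
  by rewrite /= !scaler0 !addr0.
(* Projecting the mixed brackets onto the summand [~~ c] leaves the coadjoint actions, which gives
   (C2) for [true] and (C1) for [false]. *)
- move=> [] {}i {}j {}k l u v f h /double_partP[u' ->] /double_partP[v' ->];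
  move=> /double_partP[f' ->] /double_partP[h' ->].
    rewrite !(dsum_partE, mem0v, andbT, andTb) => ui vj fk hl.
    rewrite [~~ true]/= !phir !phil !rl !rr !ll /= !coev0l !add0r.
    exact: (cocompat_pairing ui vj fk hl).
  rewrite !(dsum_partE, mem0v, andbT, andTb) => ui vj fk hl.
  rewrite [~~ false]/= !phir !phil !lr !rr !ll /= !ev0l !addr0.
  exact: (compat_pairing ui vj fk hl).
Qed.

Lemma double_manin_supertriple :
  manin_supertriple (M := M) B (dsum_map al (dual_map al)) S
    br al (dsum_inl g (dual g)) brd (dual_map al) (dsum_inr g (dual g)).
Proof.
have inlE := @dsum_inlE K g (dual g); have inrE := @dsum_inrE K g (dual g).
have phiE u : dsum_map al (dual_map al) u = pair (al (pr1 u)) (dual_map al (pr2 u)).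
  by rewrite dsum_mapE.
split.
- split; [exact: bilin_double_bracket|exact: double_bracket_even| |
          exact: double_bracket_skew|exact: double_jacobi].
  move=> i [u f]; rewrite phiE !dsum_partE => /andP[ui fi].
  by rewrite al_even ?ald_even.
- exact: g_hls.
- exact: gd_hls.
- exact: bilin_double_form.
- exact: double_form_nondeg.
- exact: double_form_sym.
- exact: double_form_inv.
- exact: double_form_twist.
- split=> [x y|i x xi|x y|x].
  + by rewrite !inlE => -[].
  + by rewrite inlE dsum_partE xi mem0v.
  + by rewrite !inlE double_bracket_inl.
  + by rewrite !inlE phiE linear0.
- split=> [x y|i x xi|x y|x].
  + by rewrite !inrE => -[].
  + by rewrite inrE dsum_partE xi mem0v.
  + by rewrite !inrE double_bracket_inr.
  + by rewrite !inrE phiE linear0.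
- by move=> x y; rewrite !inlE /= coev0r ev0l addr0.
- by move=> x y; rewrite !inrE /= coev0l ev0r addr0.
- move=> i; apply/eqP; rewrite eqEsubv; apply/andP; split.
    apply/subvP=> u /memv_addP[v /memv_imgP[x xi ->] [w /memv_imgP[f fi ->] ->]].
    by apply: rpredD; rewrite ?inlE ?inrE dsum_partE ?xi ?fi mem0v.
  apply/subvP=> -[x f]; rewrite dsum_partE => /andP[xi fi].
  have -> : pair x f = dsum_inl g (dual g) x + dsum_inr g (dual g) f.
    by rewrite inlE inrE; congr (_, _); rewrite /= ?addr0 ?add0r.
  by rewrite memv_add ?memv_img.
- apply/eqP; rewrite -subv0; apply/subvP=> u.
  rewrite memv_cap => /andP[/memv_imgP[x _ ->] /memv_imgP[f _]].
  by rewrite inlE inrE => -[-> _]; rewrite mem0v.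
Qed.
End Double.

Theorem proposition2p10 (K : fieldType) (charK0 : [pchar K] =i pred0)
    (g : superspace K) (br : g -> g -> g) (al : 'End(g))
    (brd : dual g -> dual g -> dual g)
    (g_hls : hom_lie_superalgebra br al)
    (g_mult : hom_multiplicative br al)
    (g_adm : hom_admissible br al)
    (gd_hls : hom_lie_superalgebra brd (dual_map al))
    (gd_mult : hom_multiplicative brd (dual_map al))
    (gd_adm : hom_admissible brd (dual_map al))
    (bialg : hom_lie_superbialgebra br brd al) :
  manin_supertriple (M := dsum g (dual g))
    (double_bracket br brd) (dsum_map al (dual_map al)) (@double_form K g)
    br al (dsum_inl g (dual g))
    brd (dual_map al) (dsum_inr g (dual g)).
Proof.
exact: double_manin_supertriple.
Qed.
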